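(* Let $\varepsilon>0$ and let $(\mathcal F,\Omega_{\mathcal F})$ be a symplectic foliation of a manifold $Z$. If $(\mathcal F,\Omega_{\mathcal F})$ admits prequantization, then each of its symplectic leaves $(F,\Omega_F)$, $\Omega_F=i_F^*\Omega_{\mathcal F}$, admits prequantization.
   Context: Manifolds are smooth, Hausdorff, second-countable and connected. A (regular) foliation $\mathcal F$ of $Z$ consists of the maximal integral manifolds (leaves) $i_F:F\to Z$ of an involutive distribution $T\mathcal F\subset TZ$. Leafwise forms are sections of $\bigwedge^rT\mathcal F^*$, with leafwise exterior differential $\tilde d$ (de Rham differential along $T\mathcal F$). A symplectic foliation $(\mathcal F,\Omega_{\mathcal F})$ is an even-dimensional foliation with a $\tilde d$-closed non-degenerate leafwise two-form $\Omega_{\mathcal F}$; its pull-back $\Omega_F=i_F^*\Omega_{\mathcal F}$ to each leaf $F$ is a symplectic form. A leafwise connection on a complex line bundle $C\to Z$ is a covariant derivative $\nabla^{\mathcal F}_\tau$ on sections of $C$ along sections $\tau$ of $T\mathcal F$, $C^\infty(Z)$-linear in $\tau$, with $\nabla^{\mathcal F}_\tau(fs)=(\tau\rfloor\tilde df)s+f\nabla^{\mathcal F}_\tau s$; its curvature is $\tilde R(\tau,\tau')=\nabla^{\mathcal F}_{[\tau,\tau']}-[\nabla^{\mathcal F}_\tau,\nabla^{\mathcal F}_{\tau'}]$. $(\mathcal F,\Omega_{\mathcal F})$ admits prequantization if there is a complex line bundle $C\to Z$ with a leafwise connection satisfying $\tilde R=i\varepsilon\Omega_{\mathcal F}$. A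 symplectic manifold $(F,\Omega_F)$ admits prequantization if there is a complex line bundle over $F$ with a linear connection whose curvature (same sign convention) equals $i\varepsilon\Omega_F$; the same $\varepsilon$ is used for the foliation and its leaves. *)

(* Defs.v *)
From HB Require Import structures.
From mathcomp Require Import all_boot all_order all_algebra.
From mathcomp Require Import all_classical all_reals all_analysis.
From mathcomp Require Import complex.
Import Order.TTheory GRing.Theory Num.Theory numFieldNormedType.Exports.

Set Implicit Arguments.
Unset Strict Implicit.
Unset Printing Implicit Defensive.

Local Open Scope classical_set_scope.
Local Open Scope ring_scope.

(** * Smooth manifolds *)

(* Meant for open [U]: the iterated directional derivatives of order less than
   [k] are (Frechet) differentiable on [U], those of order [k] continuous. *)
Fixpoint Ck (R : realType) (n k : nat) (U : set 'rV[R]_n) (f : 'rV[R]_n -> R)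
    : Prop :=
  match k with
  | 0 => forall x, U x -> {for x, continuous f}
  | k'.+1 => (forall x, U x -> differentiable f x) /\
             (forall v : 'rV[R]_n, Ck k' U (fun x => 'D_v f x))
  end.

Definition Cinfty (R : realType) (n : nat) (U : set 'rV[R]_n)
  (f : 'rV[R]_n -> R) : Prop := forall k, Ck k U f.

(* The charts are [chmap a], with domain [chdom a] and inverse [chinv a];
   [chmap a] and [chinv a] carry no information outside of [chdom a] and
   [chmap a @` chdom a] respectively. *)
Record manifold (R : realType) (n : nat) := Manifold {
  mpt :> topologicalType;
  chart : Type;
  chdom : chart -> set mpt;
  chmap : chart -> mpt -> 'rV[R]_n;
  chinv : chart -> 'rV[R]_n -> mpt;
  open_chdom : forall a, open (chdom a);
  cover_chdom : forall p, exists a, chdom a p;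
  open_chimg : forall a, open (chmap a @` chdom a);
  chmapK : forall a p, chdom a p -> chinv a (chmap a p) = p;
  continuous_chmap : forall a p, chdom a p -> {for p, continuous (chmap a)};
  continuous_chinv : forall a x, (chmap a @` chdom a) x ->
    {for x, continuous (chinv a)};
  smooth_transition : forall a b (j : 'I_n),
    Cinfty (chmap a @` (chdom a `&` chdom b))
           (fun x => chmap b (chinv a x) ord0 j);
  manifold_hausdorff : hausdorff_space mpt;
  manifold_second_countable : @second_countable mpt;
  manifold_connected : connected [set: mpt]
}.

Section Manifold.
Variables (R : realType) (n : nat) (M : manifold R n).

(* Meant for open [U]. *)
Definition smooth_on (U : set M) (f : M -> R) : Prop :=
  forall a : chart M,
    Cinfty (chmap a @` (chdom a `&` U)) (fun x => f (chinv a x)).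

Definition smooth (f : M -> R) : Prop := smooth_on [set: M] f.

Definition csmooth_on (U : set M) (h : M -> R[i]) : Prop :=
  smooth_on U (fun p => complex.Re (h p)) /\
  smooth_on U (fun p => complex.Im (h p)).

Definition csmooth (h : M -> R[i]) : Prop := csmooth_on [set: M] h.

(** Tangent vectors are derivations of the algebra of smooth functions.  They
    are represented as functionals on all functions; the value at non-smooth
    functions is normalized to [0], so that [=] is equality of derivations. *)
Definition tvec := (M -> R) -> R.

Definition tangent (p : M) : set tvec := [set v |
  [/\ forall (c : R) (f g : M -> R), smooth f -> smooth g ->
        v (fun q => c * f q + g q) = c * v f + v g,
      forall f g : M -> R, smooth f -> smooth g ->
        v (fun q => f q * g q) = v f * g p + f p * v g
    & forall f, ~ smooth f -> v f = 0]].

Definition cderiv (v : tvec) (h : M -> R[i]) : R[i] :=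
  Complex (v (fun q => complex.Re (h q))) (v (fun q => complex.Im (h q))).

Definition vfield := M -> tvec.

Definition smooth_vfield_on (U : set M) (X : vfield) : Prop :=
  (forall p, U p -> tangent p (X p)) /\
  (forall f, smooth f -> smooth_on U (fun p => X p f)).

(* This vanishes at non-smooth [f] because [X] and [Y] do. *)
Definition bracket (X Y : vfield) : vfield :=
  fun p f => X p (fun q => Y q f) - Y p (fun q => X q f).

(** * Foliations *)

Definition tangent_distribution := M -> set tvec.

Definition lincomb (k : nat) (X : 'I_k -> tvec) (c : 'I_k -> R) : tvec :=
  fun f => \sum_(j < k) c j * X j f.

Definition smooth_distribution (k : nat) (D : tangent_distribution) : Prop :=
  forall p : M, exists (U : set M) (X : 'I_k -> vfield),
    [/\ open U, U p, forall j, smooth_vfield_on U (X j)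
      & forall q, U q ->
          (forall c, lincomb (X^~ q) c = (fun=> 0) -> forall j, c j = 0) /\
          D q = range (lincomb (X^~ q))].

Definition section_of (D : tangent_distribution) (X : vfield) : Prop :=
  smooth_vfield_on [set: M] X /\ forall p, D p (X p).

Definition involutive (D : tangent_distribution) : Prop :=
  forall X Y, section_of D X -> section_of D Y -> section_of D (bracket X Y).

Definition foliation (k : nat) (D : tangent_distribution) : Prop :=
  smooth_distribution k D /\ involutive D.

(* A leafwise two-form [W] along [D]: only the values [W p u v] with
   [D p u] and [D p v] are meaningful. *)
Definition leafwise2 := M -> tvec -> tvec -> R.

Definition leafwise_two_form (D : tangent_distribution) (W : leafwise2) : Prop :=
  [/\ forall p (c : R) u v w, D p u -> D p v -> D p w ->
        W p (fun f => c * u f + v f) w = c * W p u w + W p v w,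
      forall p (c : R) u v w, D p u -> D p v -> D p w ->
        W p w (fun f => c * u f + v f) = c * W p w u + W p w v,
      forall p u, D p u -> W p u u = 0
    & forall X Y, section_of D X -> section_of D Y ->
        smooth (fun p => W p (X p) (Y p))].

(* Cartan's formula for the leafwise exterior differential of a two-form. *)
Definition leafwise_d2 (W : leafwise2) (X Y T : vfield) (p : M) : R :=
  X p (fun q => W q (Y q) (T q)) - Y p (fun q => W q (X q) (T q))
  + T p (fun q => W q (X q) (Y q))
  - W p (bracket X Y p) (T p) + W p (bracket X T p) (Y p)
  - W p (bracket Y T p) (X p).

Definition leafwise_closed (D : tangent_distribution) (W : leafwise2) : Prop :=
  forall X Y T, section_of D X -> section_of D Y -> section_of D T ->
    forall p, leafwise_d2 W X Y T p = 0.

Definition leafwise_nondegenerate (D : tangent_distribution) (W : leafwise2) : Prop :=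
  forall p u, D p u -> (forall v, D p v -> W p u v = 0) -> u = (fun=> 0).

Definition symplectic_foliation (k : nat) (D : tangent_distribution) (W : leafwise2)
    : Prop :=
  [/\ foliation k D, ~~ odd k, leafwise_two_form D W,
      leafwise_closed D W & leafwise_nondegenerate D W].

(** * Complex line bundles and leafwise connections *)

(* A smooth complex line bundle is given by its fibres and an atlas of local
   trivializations, fibrewise isomorphisms onto the complex numbers with smooth
   transition functions. *)
Record line_bundle := LineBundle {
  fiber : M -> lmodType R[i];
  trivialization : Type;
  tdom : trivialization -> set M;
  tmap : trivialization -> forall p : M, fiber p -> R[i];
  open_tdom : forall t, open (tdom t);
  cover_tdom : forall p, exists t, tdom t p;
  tmap_linear : forall t p, tdom t p ->
    forall (c : R[i]) (x y : fiber p),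
      tmap t (c *: x + y) = c * tmap t x + tmap t y;
  tmap_bijective : forall t p, tdom t p -> bijective (@tmap t p);
  tmap_transition : forall t t', exists2 g : M -> R[i],
    csmooth_on (tdom t `&` tdom t') g
    & forall p, tdom t p -> tdom t' p ->
        forall x : fiber p, tmap t' x = g p * tmap t x
}.

Definition csection (C : line_bundle) := forall p : M, fiber C p.

Definition smooth_csection (C : line_bundle) (s : csection C) : Prop :=
  forall t : trivialization C, csmooth_on (tdom t) (fun p => tmap t (s p)).

(* The values of [nabla] are meaningful only at smooth sections of [D] and [C].
   Allowing complex-valued functions in the Leibniz rule amounts to requiring
   the connection to be complex-linear. *)
Definition leafwise_connection (D : tangent_distribution) (C : line_bundle)
    (nabla : vfield -> csection C -> csection C) : Prop :=
  [/\ forall X s, section_of D X -> smooth_csection s ->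
        smooth_csection (nabla X s),
      forall (f : M -> R) X Y s,
        smooth f -> section_of D X -> section_of D Y -> smooth_csection s ->
        forall p, nabla (fun q g => f q * X q g + Y q g) s p
                  = Complex (f p) 0 *: nabla X s p + nabla Y s p,
      forall X s s', section_of D X -> smooth_csection s -> smooth_csection s' ->
        forall p, nabla X (fun q => s q + s' q) p = nabla X s p + nabla X s' p
    & forall (h : M -> R[i]) X s,
        csmooth h -> section_of D X -> smooth_csection s ->
        forall p, nabla X (fun q => h q *: s q) p
                  = cderiv (X p) h *: s p + h p *: nabla X s p].

Definition curvature (C : line_bundle)
    (nabla : vfield -> csection C -> csection C) (X Y : vfield)
    (s : csection C) : csection C :=
  fun p => nabla (bracket X Y) s p
           - (nabla X (nabla Y s) p - nabla Y (nabla X s) p).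

Definition admits_prequantization (eps : R) (D : tangent_distribution) (W : leafwise2)
    : Prop :=
  exists (C : line_bundle) (nabla : vfield -> csection C -> csection C),
    leafwise_connection D nabla /\
    forall X Y s, section_of D X -> section_of D Y -> smooth_csection s ->
      forall p, curvature nabla X Y s p
                = Complex 0 (eps * W p (X p) (Y p)) *: s p.

(* A linear connection is a leafwise connection along the full tangent
   bundle. *)
Definition symplectic_manifold_admits_prequantization (eps : R)
    (W : leafwise2) : Prop := admits_prequantization eps tangent W.

End Manifold.

(** * Leaves *)

Section Leaves.
Variables (R : realType) (m n : nat) (F : manifold R m) (Z : manifold R n).

Definition smooth_map (i : F -> Z) : Prop :=
  continuous i /\
  forall (a : chart F) (b : chart Z) (j : 'I_n),
    Cinfty (chmap a @` (chdom a `&` i @^-1` chdom b))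
           (fun x => chmap b (i (chinv a x)) ord0 j).

(* The normalization at non-smooth [f] makes the push-forward of a tangent
   vector a tangent vector. *)
Definition pushforward (i : F -> Z) (v : tvec F) : tvec Z :=
  fun f => if `[< smooth f >] then v (fun q => f (i q)) else 0.

Definition pullback2 (i : F -> Z) (W : leafwise2 Z) : leafwise2 F :=
  fun p u v => W (i p) (pushforward i u) (pushforward i v).

Definition immersion (i : F -> Z) : Prop :=
  smooth_map i /\
  forall p u v, tangent p u -> tangent p v ->
    pushforward i u = pushforward i v -> u = v.

Definition integral_manifold (D : tangent_distribution Z) (i : F -> Z) : Prop :=
  [/\ injective i, immersion i
    & forall p, pushforward i @` tangent p = D (i p)].

End Leaves.

Definition leaf (R : realType) (k n : nat) (Z : manifold R n)
    (D : tangent_distribution Z) (F : manifold R k) (i : F -> Z) : Prop :=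
  integral_manifold D i /\
  forall (G : manifold R k) (j : G -> Z), integral_manifold D j ->
    range i `<=` range j -> range j `<=` range i.

(* Main.v *)
From HB Require Import structures.
Require Import Defs.
From mathcomp Require Import all_boot all_order all_algebra.
From mathcomp Require Import all_classical all_reals all_analysis.
From mathcomp Require Import perm complex ring lra.
Import Order.TTheory GRing.Theory Num.Theory numFieldNormedType.Exports.

Set Implicit Arguments.
Unset Strict Implicit.
Unset Printing Implicit Defensive.

Local Open Scope classical_set_scope.
Local Open Scope ring_scope.

(** A line bundle [C] with leafwise connection on [Z] is pulled back along the
    immersion [i : F -> Z].  Near [p], a section of [i^*C] is [h *: (e \o i)]
    with [e] a section of [C] not vanishing at [i p], and the pulled back
    connection is [X h *: e (i p) + h p *: nabla W e (i p)], where [W] is any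
    section of [D] with [W (i p) = i_* (X p)]; locality and tensoriality of
    [nabla] make this independent of the choices.
    For smoothness and curvature, write [i_* X = \sum_j c_j (Y_j \o i)] in a
    local frame [Y] of [D].  The [c_j] are smooth by Cramer's rule, because the
    [Y_j] have functions dual to them at a point.  The connection form is then
    [\sum_j c_j (a_j \o i)] where [nabla Y_j e = a_j *: e], and the push-forward
    of a bracket is
    [\sum_j (X c'_j - X' c_j) Y_j + \sum_(j, l) c_j c'_l [Y_j, Y_l]],
    so that the curvature of [i^*C] is the pull-back of that of [C]. *)

(* [all_analysis] shadows this name by the push-forward of measures. *)
Local Notation pushforward := Defs.pushforward.

(** * Smooth functions on open sets of coordinate space *)

(** A leaf need not be embedded: functions, fields and sections along [F] are in general not
    restrictions of objects on [Z]. The coefficients [h] and [c_j] therefore stay on [F], and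
    whenever [nabla] needs a field on [Z], they are frozen at their values at the point in question.
    The field then agrees with [i_* X] at that point only, which tensoriality makes sufficient. A
    frozen field forgets the derivatives of the [c_j]; this is why the push-forward of a bracket
    carries the terms [X c'_j - X' c_j] explicitly. Moreover, [nabla] is controlled only on global
    smooth sections, and tangent vectors act on global functions. Each local object (frame, quotient
    of sections, Cramer coefficient) is therefore replaced by a global one with the same germ at a
    point. This requires bump functions, built here from [exp(-1/t)]. *)

Section NearDiff.
Context {R : numFieldType} {V W : normedModType R}.

(** The difference [g - f] vanishes near [x], so the zero map is its differential, and [g] is the
    sum of [f] and this difference. *)
Lemma near_eq_differentiable (f g : V -> W) x :
  (\near x, f x = g x) -> differentiable f x -> differentiable g x.
Proof.
move=> fg df.
suff d0 : differentiable (g - f) x.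
  have -> : g = f + (g - f) by rewrite addrC subrK.
  exact: differentiableD.
have h0 : \forall y \near x, (g - f) y = 0.
  by apply: filterS fg => y fgy; rewrite !fctE fgy subrr.
have hx : (g - f) x = 0 by exact: nbhs_singleton h0.
pose z : {linear V -> W} := \0.
have z0 : continuous z by move=> y; exact: cst_continuous.
have e : (g - f) \o shift x = cst ((g - f) x) + z +o_ 0 id.
  apply/eqaddoP => _ /posnumP[e].
  have : \forall y \near (0 : V), (g - f) (y + x) = 0.
    by move: h0; rewrite (near_shift 0 x) /= ; apply: filterS => y; rewrite subr0.
  apply: filterS => y hy.
  have -> : ((g - f) \o shift x - (cst ((g - f) x) + z)) y = (g - f) (y + x) - ((g - f) x + 0) by [].
  by rewrite hy hx addr0 subr0 normr0 mulr_ge0.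
by apply/diff_locallyP; rewrite (diff_unique z0 e).
Unshelve. all: by end_near. Qed.

End NearDiff.

Section CkCalculus.
Variables (R : realType) (n : nat).
Implicit Types (U : set 'rV[R]_n) (f g : 'rV[R]_n -> R).

(** Derivatives at a point of an open set depend only on the germ, so the values outside [U] never
    matter. This is what allows derivatives to be replaced by formulas valid on [U] only. *)
Lemma Ck_eq k U f g : open U -> (forall x, U x -> f x = g x) ->
  Ck k U f -> Ck k U g.
Proof.
move=> oU; elim: k f g => [|k IH] f g fg /=.
  move=> cf x Ux.
  have ne : \forall y \near x, f y = g y.
    by have := open_nbhs_nbhs (conj oU Ux); apply: filterS.
  have := cf _ Ux; rewrite /prop_for /continuous_at (fg _ Ux).
  by apply: cvg_trans; exact: (near_eq_cvg (F := nbhs x)).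
have ne x : U x -> \forall y \near x, f y = g y.
  by move=> Ux; have := open_nbhs_nbhs (conj oU Ux); apply: filterS.
move=> [df Df]; split => [x Ux|v].
  by apply: near_eq_differentiable (df _ Ux); exact: ne.
by apply: IH (Df v) => x Ux; apply: near_eq_derive; exact: ne.
Qed.

Lemma Ck_sub k U V f : V `<=` U -> Ck k U f -> Ck k V f.
Proof.
move=> VU; elim: k f => [|k IH] f /=; first by move=> cf x /VU; exact: cf.
by move=> [df Df]; split => [x /VU|v]; [exact: df|exact: IH].
Qed.

Lemma Ck_local k U f :
  (forall x, U x -> exists V, [/\ open V, V x & Ck k V f]) -> Ck k U f.
Proof.
elim: k f => [|k IH] f /= H.
  by move=> x /H[V [_ Vx]]; exact.
split=> [x /H[V [_ Vx [df _]]]|v]; first exact: df.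
by apply: IH => x /H[V [oV Vx [_ Df]]]; exists V.
Qed.

Lemma Ck_pred k U f : Ck k.+1 U f -> Ck k U f.
Proof.
elim: k f => [|k IH] f /= [df Df].
  by move=> x Ux; apply: differentiable_continuous; exact: df.
by split => // v; exact/IH/Df.
Qed.

Lemma Ck_cst k U c : Ck k U (fun=> c).
Proof.
elim: k c => [|k IH] c /=; first by move=> x _; exact: cst_continuous.
split=> [x _|v]; first exact: differentiable_cst.
have -> : 'D_v (fun=> c) = (fun=> 0) :> ('rV[R]_n -> R).
  by apply/funext => x; exact: derive_cst.
exact: IH.
Qed.

Lemma CkD k U f g : open U ->
  Ck k U f -> Ck k U g -> Ck k U (fun x => f x + g x).
Proof.
move=> oU; elim: k f g => [|k IH] f g /=.
  by move=> cf cg x Ux; exact: (@continuousD _ _ _ f g x (cf x Ux) (cg x Ux)).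
move=> [df Df] [dg Dg]; split => [x Ux|v].
  by apply: (@differentiableD _ _ _ f g); [exact: df|exact: dg].
apply: Ck_eq (IH _ _ (Df v) (Dg v)) => // x Ux.
by rewrite -deriveD//; apply: diff_derivable; [exact: df|exact: dg].
Qed.

Lemma CkM k U f g : open U ->
  Ck k U f -> Ck k U g -> Ck k U (fun x => f x * g x).
Proof.
move=> oU; elim: k f g => [|k IH] f g.
  by move=> cf cg x Ux; exact: (@continuousM _ _ f g x (cf x Ux) (cg x Ux)).
move=> cf cg.
move: (cf) (cg) => [df Df] [dg Dg]; split => [x Ux|v].
  by apply: (@differentiableM _ _ f g); [exact: df|exact: dg].
apply: Ck_eq (CkD oU (IH _ _ (Ck_pred cf) (Dg v)) (IH _ _ (Ck_pred cg) (Df v))) => //.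
move=> x Ux.
by rewrite -(@deriveM _ _ f g)//; apply: diff_derivable; [exact: df|exact: dg].
Qed.

Lemma CkV k U f : open U -> (forall x, U x -> f x != 0) ->
  Ck k U f -> Ck k U (fun x => (f x)^-1).
Proof.
move=> oU f0; elim: k => [|k IH].
  by move=> cf x Ux; exact: (@continuousV _ _ f x (f0 x Ux) (cf x Ux)).
move=> cf; move: (cf) => [df Df]; split => [x Ux|v].
  by apply: differentiableV; [exact: df|exact: f0].
have cV := IH (Ck_pred cf).
apply: Ck_eq (CkM oU (Ck_cst k U (-1)) (CkM oU (CkM oU cV cV) (Df v))) => //.
move=> x Ux; rewrite deriveV ?f0//; last exact/diff_derivable/df.
by rewrite /GRing.scale /= mulN1r mulNr expr2 invfM.
Qed.

Lemma Ck_sum k U (I : Type) (r : seq I) (F : I -> 'rV[R]_n -> R) : open U ->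
  (forall i, Ck k U (F i)) -> Ck k U (fun x => \sum_(i <- r) F i x).
Proof.
move=> oU cF; elim: r => [|i r IH].
  by under eq_fun do rewrite big_nil; exact: Ck_cst.
by under eq_fun do rewrite big_cons; exact: CkD.
Qed.

Lemma Ck_coord k U j : Ck k U (fun x => x ord0 j).
Proof.
case: k => [|k] /=; first by move=> x _; exact: coord_continuous.
split=> [x _|v]; first exact: differentiable_coord.
have -> : 'D_v (fun x : 'rV[R]_n => x ord0 j) = fun=> v ord0 j.
  apply/funext => x; have := @derive_mx R 'rV[R]_n 1 n id x v (@derivable_id _ _ x v).
  by rewrite derive_id => /matrixP/(_ ord0 j); rewrite mxE => ->.
exact: Ck_cst.
Qed.

End CkCalculus.

(** By the chain rule the derivative of [f \o phi] along [v] is the sum over [j] of ['D_v phi_j]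
    times the [j]-th partial derivative of [f] at [phi]; the induction hypothesis applies to these
    partial derivatives. *)
Lemma Ck_comp (R : realType) (m n k : nat) (U : set 'rV[R]_m)
    (W : set 'rV[R]_n) (phi : 'rV[R]_m -> 'rV[R]_n) (f : 'rV[R]_n -> R) :
  open U -> (forall x, U x -> W (phi x)) ->
  (forall j, Ck k U (fun x => phi x ord0 j)) ->
  Ck k W f -> Ck k U (fun x => f (phi x)).
Proof.
move=> oU UW; elim: k f => [|k IH] f.
  move=> cphi cf x Ux.
  apply: (@continuous_comp _ _ _ phi f); last exact/cf/UW.
  (* The norm of a row vector is the maximum over its entries, so finitely many coordinate estimates
     give the continuity of [phi]. *)
  apply/(@cvgrPdist_le _ _ _ (nbhs x) (nbhs_filter x)) => e e0.
  have : nbhs x [set y | forall j, `|phi x ord0 j - phi y ord0 j| < e].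
    apply: (@filter_forall _ _ _ (nbhs x) (nbhs_filter x)) => j.
    by have /cvgrPdist_lt := cphi j x Ux; apply.
  apply: (@filterS _ (nbhs x) (nbhs_filter x)) => y Hy; rewrite [leLHS]/Num.norm /= mx_normrE.
  by rewrite (bigmax_le _ (ltW e0))//= => -[i j] _; rewrite !mxE (ord1 i) ltW.
move=> cphi [df Df].
have dphi x : U x -> differentiable phi x.
  move=> Ux.
  have -> : phi = \sum_(j < n) (fun x => phi x ord0 j *: delta_mx 0 j).
    apply/funext => y; rewrite fct_sumE; exact: row_sum_delta.
  apply: differentiable_sum => j; apply: differentiableZl.
  by case: (cphi j) => + _; exact.
split => [x Ux|v].
  by apply: (@differentiable_comp _ _ _ _ phi f); [exact: dphi|exact: (df _ (UW _ Ux))].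
have H : Ck k U (fun x => \sum_j 'D_v (fun x => phi x ord0 j) x *
                     'D_(delta_mx 0 j) f (phi x)).
  apply: Ck_sum => // j; apply: CkM => //; first by case: (cphi j) => _; apply.
  apply: (IH ('D_(delta_mx 0 j) f)); last exact: Df.
  by move=> l; apply: Ck_pred; exact: cphi.
apply: Ck_eq H => // x Ux.
have Wx := UW _ Ux.
rewrite deriveE; last first.
  by apply: (@differentiable_comp _ _ _ _ phi f); [exact: dphi|exact: (df _ Wx)].
rewrite (@diff_comp _ _ _ _ phi f x (dphi _ Ux) (df _ Wx)) /=.
rewrite -(@deriveE _ _ _ phi x v (dphi _ Ux)).
rewrite derive_mx; last by apply: diff_derivable; exact: dphi.
rewrite [X in 'd f _ X]row_sum_delta linear_sum; apply: eq_bigr => j _.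
by rewrite linearZ mxE -(@deriveE _ _ _ f _ _ (df _ Wx)).
Qed.

(** * Flat functions and bump functions on coordinate space *)

Section Psi.
Variable R : realType.

(* The family [t^-m e^(-1/t)], extended by 0, is stable under differentiation
   up to linear combinations. *)
Definition psi (m : nat) (t : R) : R :=
  if 0 < t then t^-1 ^+ m * expR (- t^-1) else 0.

Lemma psi_ge0 m t : 0 <= psi m t.
Proof.
by rewrite /psi; case: ifP => // t0; rewrite mulr_ge0 ?expR_ge0 ?exprn_ge0 ?invr_ge0 ?ltW.
Qed.

Lemma psi_gt0 m t : 0 < t -> 0 < psi m t.
Proof. by move=> t0; rewrite /psi t0 mulr_gt0 ?expR_gt0 ?exprn_gt0 ?invr_gt0. Qed.

Lemma psi_le0 m t : t <= 0 -> psi m t = 0.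
Proof. by rewrite /psi leNgt; case: ifP. Qed.

(** For [u = 1/t] the exponential series gives [u^(m+1) / (m+1)! <= exp u], hence
    [u^m exp(-u) <= (m+1)! t]. The linear bound is what makes [psi] flat at 0. *)
Lemma psi_le m t : psi m t <= m.+1`!%:R * `|t|.
Proof.
rewrite /psi; case: ifPn => [t0|_]; last by rewrite mulr_ge0.
rewrite expRN ler_pdivrMr ?expR_gt0//.
have u0 : 0 < t^-1 by rewrite invr_gt0.
have := expR_ge1Dxn m (ltW u0).
have F0 : 0 < m.+1`!%:R :> R by rewrite ltr0n fact_gt0.
move=> h; have {}h : t^-1 ^+ m.+1 / m.+1`!%:R <= expR t^-1.
  by apply: le_trans h; rewrite lerDr.
rewrite gtr0_norm// -mulrA.
have -> : t^-1 ^+ m = m.+1`!%:R * (t * (t^-1 ^+ m.+1 / m.+1`!%:R)).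
  by rewrite exprS; field; rewrite ?gt_eqF.
by rewrite !ler_pM2l.
Qed.

Lemma psi_is_derive m (t : R) :
  is_derive t (1 : R) (psi m) (- m%:R * psi m.+1 t + psi m.+2 t).
Proof.
have [t0|t0|->] := ltgtP t 0.
- rewrite !psi_le0 ?ltW// mulr0 addr0.
  apply: (@near_eq_is_derive R R R (cst 0)).
  by near=> u; rewrite /cst psi_le0//; apply: ltW; near: u; exact: lt_nbhsl.
- apply: (@near_eq_is_derive R R R (fun t => t^-1 ^+ m * expR (- t^-1))).
    near=> u; rewrite /psi ifT//; near: u; exact: lt_nbhsr.
  have t0' : t != 0 by rewrite gt_eqF.
  have dV : is_derive t 1 (fun t : R => t^-1) (- t ^- 2).
    have := @realfun.is_deriveV R id t 1 1 t0' (is_derive_id _ _).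
    by rewrite /GRing.scale /= mulr1.
  have dX := @is_deriveX R R (fun t : R => t^-1) m t 1 _ dV.
  rewrite exprfctE in dX.
  have dN : is_derive t 1 (fun t : R => - t^-1) (t^- 2).
    by have := @is_deriveN R R R (fun t : R => t^-1) t 1 _ dV; rewrite opprK.
  have dE : is_derive t 1 (fun t : R => expR (- t^-1)) (t^-2 * expR (- t^-1)).
    have := @is_derive1_comp R expR (fun t : R => - t^-1) t _ _ (is_derive_expR _) dN.
    by rewrite mulrC.
  have := @is_deriveM R R _ _ t 1 _ _ dX dE.
  move/is_derive_eq; apply.
  rewrite /psi t0 /GRing.scale /= !exprS.
  (* The truncated predecessor is harmless: for [m = 0] both sides vanish because of the factor
     [m]. *)
  have -> : m%:R * t^-1 ^+ m.-1 = m%:R * (t * t^-1 ^+ m).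
    case: (m) => [|p] /=; first by rewrite !mul0r.
    by rewrite exprS mulVKf.
  by field.
rewrite !psi_le0// mulr0 addr0.
(* The difference quotient of [psi m] at 0 is [psi m.+1 h], which tends to 0 by the linear bound. *)
have c0 : (fun h => h^-1 *: ((psi m \o shift 0) (h *: 1) - psi m 0)) @ 0^' --> 0.
  apply/cvgrPdist_lt => e e0; near=> h.
  have F0 : 0 < m.+2`!%:R :> R by rewrite ltr0n fact_gt0.
  rewrite sub0r normrN /= /shift /= addr0 /GRing.scale /= mulr1 (psi_le0 m (lexx 0)) subr0.
  apply: (@le_lt_trans _ _ (m.+2`!%:R * `|h|)).
    have h0 : h != 0 by near: h; exact: nbhs_dnbhs_neq.
    have -> : h^-1 * psi m h = psi m.+1 h.
      by rewrite /psi; case: ifP; rewrite ?mulr0// exprS mulrA.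
    by rewrite ger0_norm ?psi_ge0 ?psi_le.
  rewrite -ltr_pdivlMl//; near: h; apply: dnbhs0_lt.
  by rewrite mulrC divr_gt0.
apply: DeriveDef; first by apply/cvg_ex; exists 0.
exact: cvg_lim c0.
Unshelve. all: by end_near. Qed.
End Psi.

Section PsiComp.
Variables (R : realType) (n : nat).
Implicit Types (U : set 'rV[R]_n) (f : 'rV[R]_n -> R).

(** The induction on [k] treats all [m] at once, since differentiating [psi m] produces [psi m.+1]
    and [psi m.+2]. *)
Lemma Ck_psi k m U f : open U -> Ck k U f -> Ck k U (fun x => psi m (f x)).
Proof.
move=> oU; elim: k m f => [|k IH] m f.
  move=> cf x Ux; apply: (@continuous_comp _ _ _ f (psi m)); first exact: cf.
  apply: differentiable_continuous; apply/derivable1_diffP.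
  by case: (psi_is_derive m (f x)).
move=> cf; move: (cf) => [df Df].
have dpsi t : differentiable (psi m : R -> R) t.
  by apply/derivable1_diffP; case: (psi_is_derive m t).
split=> [x Ux|v].
  by apply: (@differentiable_comp _ _ _ _ f (psi m)); [exact: df|exact: dpsi].
have cf' := Ck_pred cf.
have H := CkM oU (CkD oU (CkM oU (Ck_cst k U (- m%:R)) (IH m.+1 f cf')) (IH m.+2 f cf')) (Df v).
apply: Ck_eq H => // x Ux.
have dc := (@differentiable_comp R _ R R f (psi m) x (df _ Ux) (dpsi _)).
rewrite -[RHS]/('D_v (psi m \o f) x) (deriveE v dc).
rewrite (@diff_comp _ _ _ _ f (psi m) x (df _ Ux) (dpsi _)) /=.
rewrite -(@deriveE _ _ _ f x v (df _ Ux)) deriv1E ?derive1E; last first.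
  by case: (psi_is_derive m (f x)).
by case: (psi_is_derive m (f x)) => _ ->; rewrite /GRing.scale /= mulrC.
Qed.

(** The sum of squares is used because it is smooth, unlike the maximum norm. Its ball of radius [r]
    lies in the closed cube [K] of half-side [r = e / 2], and [K] lies in the open ball of radius
    [e] for the maximum norm. *)
Lemma bump_rV (c : 'rV[R]_n) (V : set 'rV[R]_n) : nbhs c V ->
  exists (b : 'rV[R]_n -> R) (K : set 'rV[R]_n),
    [/\ Cinfty setT b, 0 < b c, compact K, K `<=` V
      & forall x, ~ K x -> b x = 0].
Proof.
move=> /nbhs_ballP[e /= e0 eV].
have r0 : 0 < e / 2 by rewrite divr_gt0.
set r := e / 2 in r0 *.
pose s (x : 'rV[R]_n) := r ^+ 2 - \sum_j (x ord0 j - c ord0 j) ^+ 2.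
exists (fun x => psi 0 (s x)).
exists [set x : 'rV[R]_n | forall j, [set` `[c ord0 j - r, c ord0 j + r]] (x ord0 j)].
split.
- move=> k; apply: Ck_psi; first exact: openT.
  apply: CkD; [exact: openT|exact: Ck_cst|].
  have -> : (fun x : 'rV[R]_n => - \sum_j (x ord0 j - c ord0 j) ^+ 2)
     = fun x => -1 * \sum_j (x ord0 j - c ord0 j) ^+ 2.
    by apply/funext => x; rewrite mulN1r.
  apply: CkM; [exact: openT|exact: Ck_cst|].
  have cj j : Ck k setT (fun x : 'rV[R]_n => x ord0 j - c ord0 j).
    by apply: CkD; [exact: openT|exact: Ck_coord|exact: Ck_cst].
  by apply: Ck_sum => [|j]; [exact: openT|apply: CkM => //; exact: openT].
- apply: psi_gt0; rewrite /s big1 => [|j _]; last by rewrite subrr expr0n.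
  by rewrite subr0 exprn_gt0.
- by apply: (@rV_compact R n (fun j => [set` `[c ord0 j - r, c ord0 j + r]])) => j; exact: segment_compact.
- move=> x /= xK; apply: eV; split => // i j; rewrite (ord1 i).
  have := xK j; rewrite /= in_itv /= => /andP[h1 h2].
  rewrite /ball /= distrC (@le_lt_trans _ _ r)//; last first.
    by rewrite /r ltr_pdivrMr// ltr_pMr// ltr1n.
  by rewrite ler_norml; apply/andP; split; lra.
- move=> x xK; apply: psi_le0; rewrite leNgt; apply/negP => s0; apply: xK => j /=.
  have xr : (x ord0 j - c ord0 j) ^+ 2 <= r ^+ 2.
    apply: ltW; apply: (@le_lt_trans _ _ (\sum_l (x ord0 l - c ord0 l) ^+ 2)).
      by rewrite (bigD1 j)//= lerDl sumr_ge0// => l _; exact: sqr_ge0.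
    by rewrite -subr_gt0.
  rewrite in_itv /=.
  have : `|x ord0 j - c ord0 j| <= r.
    by rewrite -(ler_pXn2r (n := 2)) ?nnegrE ?(ltW r0)// real_normK ?num_real.
  by rewrite ler_norml => /andP[? ?]; apply/andP; split; lra.
Qed.

End PsiComp.

(** * Smooth functions and bump functions on manifolds *)

Section ManifoldCalculus.
Variables (R : realType) (n : nat) (M : manifold R n).
Implicit Types (U V : set M) (f g : M -> R).

(** Inside the open image of the chart, the set is the preimage of [U] under the continuous inverse
    chart. *)
Lemma open_cimg (a : chart M) U : open U -> open (chmap a @` (chdom a `&` U)).
Proof.
move=> oU; rewrite openE => _ [p [ap Up] <-].
have ip : (chmap a @` chdom a) (chmap a p) by exists p.
have h1 := open_nbhs_nbhs (conj (@open_chimg _ _ M a) ip).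
have h2 : nbhs (chmap a p) (chinv a @^-1` (chdom a `&` U)).
  apply: (continuous_chinv ip); rewrite (chmapK ap).
  by apply: open_nbhs_nbhs; split => //; apply: openI => //; exact: open_chdom.
apply: (filterS2 _ _ h1 h2) => _ [q aq <-] /=; rewrite (chmapK aq) => aUq.
by exists q.
Qed.

Lemma smooth_on_eq U f g : open U -> (forall p, U p -> f p = g p) ->
  smooth_on U f -> smooth_on U g.
Proof.
move=> oU fg sf a k; apply: Ck_eq (sf a k); first exact: open_cimg.
by move=> _ [p [ap Up] <-]; rewrite (chmapK ap) fg.
Qed.

Lemma smooth_on_sub U V f : V `<=` U -> smooth_on U f -> smooth_on V f.
Proof.
move=> VU sf a k; apply: Ck_sub (sf a k).
by apply: image_subset => p [? /VU].
Qed.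

Lemma smooth_smooth_on U f : smooth f -> smooth_on U f.
Proof. exact: smooth_on_sub. Qed.

Lemma smooth_on_local U f :
  (forall p, U p -> exists V, [/\ open V, V p & smooth_on V f]) ->
  smooth_on U f.
Proof.
move=> H a k; apply: Ck_local => _ [p [ap Up] <-].
have [V [oV Vp sV]] := H p Up.
exists (chmap a @` (chdom a `&` V)); split; [exact: open_cimg|by exists p|].
exact: sV.
Qed.

Lemma smooth_on_cst U c : smooth_on U (fun=> c).
Proof. by move=> a k; exact: Ck_cst. Qed.

Lemma smooth_onD U f g : open U -> smooth_on U f -> smooth_on U g ->
  smooth_on U (fun p => f p + g p).
Proof.
by move=> oU sf sg a k; apply: CkD; [exact: open_cimg|exact: sf|exact: sg].
Qed.

Lemma smooth_onM U f g : open U -> smooth_on U f -> smooth_on U g ->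
  smooth_on U (fun p => f p * g p).
Proof.
by move=> oU sf sg a k; apply: CkM; [exact: open_cimg|exact: sf|exact: sg].
Qed.

Lemma smooth_onN U f : open U -> smooth_on U f -> smooth_on U (fun p => - f p).
Proof.
move=> oU sf; under eq_fun do rewrite -mulN1r.
exact: (smooth_onM oU (@smooth_on_cst U (-1)) sf).
Qed.

Lemma smooth_onB U f g : open U -> smooth_on U f -> smooth_on U g ->
  smooth_on U (fun p => f p - g p).
Proof. by move=> oU sf sg; exact: (smooth_onD oU sf (smooth_onN oU sg)). Qed.

Lemma smooth_on_sum U (I : Type) (r : seq I) (F : I -> M -> R) : open U ->
  (forall i, smooth_on U (F i)) -> smooth_on U (fun p => \sum_(i <- r) F i p).
Proof.
move=> oU sF; elim: r => [|i r IH].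
  by under eq_fun do rewrite big_nil; exact: smooth_on_cst.
by under eq_fun do rewrite big_cons; exact: (smooth_onD oU (sF i) IH).
Qed.

Lemma smooth_on_prod U (I : Type) (r : seq I) (F : I -> M -> R) : open U ->
  (forall i, smooth_on U (F i)) -> smooth_on U (fun p => \prod_(i <- r) F i p).
Proof.
move=> oU sF; elim: r => [|i r IH].
  by under eq_fun do rewrite big_nil; exact: smooth_on_cst.
by under eq_fun do rewrite big_cons; exact: (smooth_onM oU (sF i) IH).
Qed.

Lemma smooth_onV U f : open U -> (forall p, U p -> f p != 0) ->
  smooth_on U f -> smooth_on U (fun p => (f p)^-1).
Proof.
move=> oU f0 sf a k; apply: CkV; [exact: open_cimg| |exact: sf].
by move=> _ [p [ap Up] <-]; rewrite (chmapK ap) f0.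
Qed.

Lemma smooth_on_continuous U f p : U p -> open U -> smooth_on U f ->
  {for p, continuous f}.
Proof.
move=> Up oU sf; have [a ap] := cover_chdom p.
have c1 : {for chmap a p, continuous (fun x => f (chinv a x))}.
  by apply: (sf a 0%N); exists p.
have c2 := @continuous_comp _ _ _ (chmap a) (fun x => f (chinv a x)) p
  (continuous_chmap ap) c1.
have ne : \forall q \near p, (f \o (chinv a \o chmap a)) q = f q.
  have := open_nbhs_nbhs (conj (@open_chdom _ _ M a) ap).
  by apply: filterS => q aq /=; rewrite (chmapK aq).
move: c2; rewrite /prop_for /continuous_at /= (chmapK ap).
apply: cvg_trans; apply: (near_eq_cvg (F := nbhs p)).
by move: ne; apply: filterS => q /= ->.
Qed.

Lemma smooth_on_psi m U f : open U -> smooth_on U f ->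
  smooth_on U (fun p => psi m (f p)).
Proof.
by move=> oU sf a k; apply: Ck_psi; [exact: open_cimg|exact: sf].
Qed.

End ManifoldCalculus.

(** In charts [a] of [F] and [b] of [Z], the function [f \o i] is [f \o b^-1] after
    [b \o i \o a^-1]. Continuity of [i] provides an open set on which the chart [b] can be used. *)
Lemma smooth_on_comp (R : realType) (m n : nat) (F : manifold R m)
    (Z : manifold R n) (i : F -> Z) (U : set Z) (f : Z -> R) :
  smooth_map i -> open U -> smooth_on U f ->
  smooth_on (i @^-1` U) (fun p => f (i p)).
Proof.
move=> [ci si] oU sf; apply: smooth_on_local => p Up.
have [b bp] := cover_chdom (i p).
have oV : open (i @^-1` (U `&` chdom b)).
  by apply: open_comp => [q _|]; [exact: ci|apply: openI => //; exact: open_chdom].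
exists (i @^-1` (U `&` chdom b)); split => // a k.
set A := chmap a @` _.
have oA : open A by exact: open_cimg.
have H : Ck k A (fun x => f (chinv b (chmap b (i (chinv a x))))).
  apply: (@Ck_comp _ _ _ _ _ (chmap b @` (chdom b `&` U))
    (fun x => chmap b (i (chinv a x))) (fun y => f (chinv b y))) => //.
  - by move=> _ [q [aq [Uq bq]] <-]; rewrite (chmapK aq); exists (i q).
  - move=> j; apply: Ck_sub (si a b j k).
    by apply: image_subset => q [aq [Uq bq]].
  - exact: sf.
apply: Ck_eq H => // _ [q [aq [Uq bq]] <-].
by rewrite (chmapK aq) (chmapK bq).
Qed.

Section Bump.
Variables (R : realType) (n : nat) (M : manifold R n).
Implicit Types (U V : set M) (f g : M -> R).

Lemma smooth_map_id : smooth_map (@id M).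
Proof. by split => [p|a b j]; [exact: cvg_id|exact: (smooth_transition a b j)]. Qed.

Lemma smooth_on_chart (a : chart M) (U : set M) (b : 'rV[R]_n -> R) :
  open U -> U `<=` chdom a -> Cinfty setT b ->
  smooth_on U (fun p => b (chmap a p)).
Proof.
move=> oU Ua sb c k.
apply: (@Ck_comp _ _ _ _ _ setT (fun x => chmap a (chinv c x)) b) => //.
  exact: open_cimg.
move=> j; apply: Ck_sub (smooth_transition c a j k).
by apply: image_subset => p [cp /Ua].
Qed.

(** The open sets [U] and the complement of [C] cover [M]; the product is smooth on the first and
    zero on the second, whatever [f] is outside [U]. *)
Lemma smooth_extend0 (U C : set M) (rho f : M -> R) :
  open U -> closed C -> C `<=` U -> smooth_on U rho -> smooth_on U f ->
  (forall q, ~ C q -> rho q = 0) -> smooth (fun q => rho q * f q).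
Proof.
move=> oU cC CU sr sf r0; apply: smooth_on_local => p _.
have [Up|nUp] := pselect (U p).
  by exists U; split => //; exact: (smooth_onM oU sr sf).
exists (~` C); split; [exact: closed_openC|by move=> /CU|].
apply: (smooth_on_eq (f := fun=> 0)); [exact: closed_openC| |exact: smooth_on_cst].
by move=> q nCq; rewrite r0// mul0r.
Qed.

Lemma bump_pos (p : M) (U : set M) : open U -> U p ->
  exists (rho : M -> R) (C : set M),
  [/\ smooth rho, 0 < rho p, closed C, C `<=` U & forall q, ~ C q -> rho q = 0].
Proof.
move=> oU Up; have [a ap] := cover_chdom p.
have oaU : open (chmap a @` (chdom a `&` U)) by exact: open_cimg.
have nb : nbhs (chmap a p) (chmap a @` (chdom a `&` U)).
  by apply: open_nbhs_nbhs; split => //; exists p.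
have [b [K [sb b0 cK KU bK]]] := bump_rV nb.
(* Being compact in a Hausdorff space, [C] is closed in [M]; hence the extension [chi] by 0 is also
   smooth at the boundary of the chart domain. *)
pose C := chinv a @` K.
have cC : closed C.
  apply: compact_closed; first exact: manifold_hausdorff.
  apply: continuous_compact => //.
  apply: continuous_in_subspaceT => x /set_mem /KU [q [aq _] <-].
  by apply: continuous_chinv; exists q.
have CU : C `<=` chdom a `&` U.
  by move=> _ [x /KU [q [aq Uq] <-] <-]; rewrite (chmapK aq).
pose chi (q : M) : R := if `[< chdom a q >] then b (chmap a q) else 0.
have chiC q : ~ C q -> chi q = 0.
  rewrite /chi; case: asboolP => // aq nCq; apply: bK => Kq; apply: nCq.
  by exists (chmap a q) => //; rewrite (chmapK aq).
exists chi, C; split => //.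
- apply: smooth_on_local => q _.
  have [aq|nq] := pselect (chdom a q).
    exists (chdom a); split => //; first exact: open_chdom.
    apply: smooth_on_eq (smooth_on_chart (@open_chdom _ _ M a) (@subset_refl _ _) sb).
      exact: open_chdom.
    by move=> r ar; rewrite /chi; case: asboolP.
  exists (~` C); split; [exact: closed_openC|by move=> /CU[]|].
  apply: (smooth_on_eq (f := fun=> 0)); [exact: closed_openC| |exact: smooth_on_cst].
  by move=> r nCr; rewrite chiC.
- by rewrite /chi; case: asboolP.
- by move=> q /CU[].
Qed.

(** The quotient [psi 0 chi / (psi 0 chi + psi 0 (c - chi))] is 0 where [chi <= 0] and 1 where
    [chi >= c]. With [c = chi p / 2 > 0] the two terms of the denominator never vanish together, and
    the value is 1 near [p], not merely at [p]. *)
Lemma bump (p : M) (U : set M) : open U -> U p ->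
  exists (rho : M -> R) (C V : set M),
  [/\ smooth rho, closed C, C `<=` U & forall q, ~ C q -> rho q = 0] /\
  [/\ open V, V p, V `<=` U & forall q, V q -> rho q = 1].
Proof.
move=> oU Up; have [chi [C [schi chip cC CU chiC]]] := bump_pos oU Up.
set c := chi p / 2.
have c0 : 0 < c by rewrite divr_gt0.
pose den (q : M) := psi 0 (chi q) + psi 0 (c - chi q).
have den0 q : 0 < den q.
  rewrite /den; have [h|h] := ltP 0 (chi q).
    by apply: ltr_wpDr; [exact: psi_ge0|exact: psi_gt0].
  apply: ltr_wpDl; [exact: psi_ge0|apply: psi_gt0].
  by rewrite subr_gt0 (le_lt_trans h).
pose V := U `&` chi @^-1` [set x | c < x].
exists (fun q => psi 0 (chi q) * (den q)^-1), C, V; split; split => //.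
- have oT : open [set: M] by exact: openT.
  have s1 := smooth_on_psi 0 oT schi.
  have s2 := smooth_on_psi 0 oT (smooth_onB oT (@smooth_on_cst _ _ M setT c) schi).
  have dn0 q : [set: M] q -> den q != 0 by rewrite gt_eqF.
  exact: (smooth_onM oT s1 (smooth_onV oT dn0 (smooth_onD oT s1 s2))).
- by move=> q /chiC h; rewrite h psi_le0// mul0r.
- apply: openI => //; apply: open_comp; last exact: open_gt.
  by move=> q _; apply: (smooth_on_continuous (U := setT)) => //; exact: openT.
- by split => //=; rewrite /c ltr_pdivrMr// ltr_pMr// ltr1n.
- by move=> q [].
- move=> q [_ /= cq]; rewrite /den (@psi_le0 _ _ (c - _)) ?subr_le0 ?(ltW cq)//.
  by rewrite addr0 divff// gt_eqF// psi_gt0// (lt_trans c0).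
Qed.

Lemma smooth_extend (p : M) (U : set M) f : open U -> U p -> smooth_on U f ->
  exists (g : M -> R) (V : set M),
  [/\ smooth g, open V, V p, V `<=` U & forall q, V q -> g q = f q].
Proof.
move=> oU Up sf; have [rho [C [V [[sr cC CU rC] [oV Vp VU r1]]]]] := bump oU Up.
exists (fun q => rho q * f q), V; split => //.
  by apply: smooth_extend0 cC CU _ sf rC => //; exact: smooth_smooth_on.
by move=> q Vq; rewrite r1// mul1r.
Qed.

End Bump.

(** * Complex functions and derivations *)

Lemma complex_eq (R : realType) (x y : R[i]) :
  complex.Re x = complex.Re y -> complex.Im x = complex.Im y -> x = y.
Proof. by case: x y => [a b] [c d] /= -> ->. Qed.

Section ReIm.
Variable R : realType.
Implicit Types x y : R[i].
Lemma ReD x y : complex.Re (x + y) = complex.Re x + complex.Re y.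
Proof. by case: x y => [a b] [c d]. Qed.
Lemma ImD x y : complex.Im (x + y) = complex.Im x + complex.Im y.
Proof. by case: x y => [a b] [c d]. Qed.
Lemma ReM x y : complex.Re (x * y)
  = complex.Re x * complex.Re y - complex.Im x * complex.Im y.
Proof. by case: x y => [a b] [c d]. Qed.
Lemma ImM x y : complex.Im (x * y)
  = complex.Re x * complex.Im y + complex.Im x * complex.Re y.
Proof. by case: x y => [a b] [c d]. Qed.
Lemma ReN x : complex.Re (- x) = - complex.Re x.
Proof. by case: x. Qed.
Lemma ImN x : complex.Im (- x) = - complex.Im x.
Proof. by case: x. Qed.
Definition ReImE := (ReD, ImD, ReM, ImM, ReN, ImN).
End ReIm.

Section CSmooth.
Variables (R : realType) (n : nat) (M : manifold R n).
Implicit Types (U V : set M) (f g : M -> R) (h k : M -> R[i]).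

Lemma csmooth_on_eq U h k : open U -> (forall p, U p -> h p = k p) ->
  csmooth_on U h -> csmooth_on U k.
Proof.
move=> oU hk [sr si]; split.
- by apply: smooth_on_eq oU _ sr => p Up; rewrite hk.
- by apply: smooth_on_eq oU _ si => p Up; rewrite hk.
Qed.

Lemma csmooth_on_sub U V h : V `<=` U -> csmooth_on U h -> csmooth_on V h.
Proof. by move=> VU [sr si]; split; apply: smooth_on_sub VU _. Qed.

Lemma csmooth_on_local U h :
  (forall p, U p -> exists V, [/\ open V, V p & csmooth_on V h]) ->
  csmooth_on U h.
Proof.
move=> H; split; apply: smooth_on_local => p /H[V [oV Vp [sr si]]]; by exists V.
Qed.

Lemma csmooth_on_cst U c : csmooth_on U (fun=> c).
Proof. by split; exact: (smooth_on_cst (M := M)). Qed.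

Lemma csmooth_on_real U f : smooth_on U f -> csmooth_on U (fun p => Complex (f p) 0).
Proof. by move=> sf; split => //; exact: (smooth_on_cst (M := M)). Qed.

Lemma csmooth_onD U h k : open U -> csmooth_on U h -> csmooth_on U k ->
  csmooth_on U (fun p => h p + k p).
Proof.
move=> oU [hr hi] [kr ki]; split.
- by under eq_fun do rewrite ReD; exact: (smooth_onD oU hr kr).
- by under eq_fun do rewrite ImD; exact: (smooth_onD oU hi ki).
Qed.

Lemma csmooth_onM U h k : open U -> csmooth_on U h -> csmooth_on U k ->
  csmooth_on U (fun p => h p * k p).
Proof.
move=> oU [hr hi] [kr ki]; split.
- under eq_fun do rewrite ReM.
  exact: (smooth_onB oU (smooth_onM oU hr kr) (smooth_onM oU hi ki)).
- under eq_fun do rewrite ImM.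
  exact: (smooth_onD oU (smooth_onM oU hr ki) (smooth_onM oU hi kr)).
Qed.

Lemma csmooth_on_sum U (I : Type) (r : seq I) (F : I -> M -> R[i]) : open U ->
  (forall i, csmooth_on U (F i)) -> csmooth_on U (fun p => \sum_(i <- r) F i p).
Proof.
move=> oU sF; elim: r => [|i r IH].
  by under eq_fun do rewrite big_nil; exact: csmooth_on_cst.
by under eq_fun do rewrite big_cons; exact: (csmooth_onD oU (sF i) IH).
Qed.

Lemma csmooth_onV U h : open U -> (forall p, U p -> h p != 0) ->
  csmooth_on U h -> csmooth_on U (fun p => (h p)^-1).
Proof.
move=> oU h0 [hr hi].
pose N p := complex.Re (h p) * complex.Re (h p) + complex.Im (h p) * complex.Im (h p).
have sN := smooth_onD oU (smooth_onM oU hr hr) (smooth_onM oU hi hi).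
have N0 p : U p -> N p != 0.
  move=> /h0; apply: contra_neq => /eqP.
  rewrite /N paddr_eq0 -?expr2 ?sqr_ge0// !sqrf_eq0 => /andP[/eqP a /eqP b].
  exact: complex_eq.
have sV := smooth_onV oU N0 sN.
split.
- apply: (smooth_on_eq oU _ (smooth_onM oU hr sV)) => p _ /=; rewrite /N.
  by case: (h p) => a b /=; rewrite -!expr2.
- apply: (smooth_on_eq oU _ (smooth_onN oU (smooth_onM oU hi sV))) => p _ /=; rewrite /N.
  by case: (h p) => a b /=; rewrite -!expr2.
Qed.

Lemma csmooth_extend0 (U C : set M) (rho : M -> R) h :
  open U -> closed C -> C `<=` U -> smooth_on U rho -> csmooth_on U h ->
  (forall q, ~ C q -> rho q = 0) -> csmooth (fun q => Complex (rho q) 0 * h q).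
Proof.
move=> oU cC CU sr [hr hi] r0; split.
- apply: smooth_on_eq (smooth_extend0 oU cC CU sr hr r0); first exact: openT.
  by move=> p _; rewrite ReM /= mul0r subr0.
- apply: smooth_on_eq (smooth_extend0 oU cC CU sr hi r0); first exact: openT.
  by move=> p _; rewrite ImM /= mul0r addr0.
Qed.

Lemma csmooth_extend (p : M) (U : set M) h : open U -> U p -> csmooth_on U h ->
  exists (k : M -> R[i]) (V : set M),
  [/\ csmooth k, open V, V p, V `<=` U & forall q, V q -> k q = h q].
Proof.
move=> oU Up sh; have [rho [C [V [[sr cC CU rC] [oV Vp VU r1]]]]] := bump oU Up.
exists (fun q => Complex (rho q) 0 * h q), V; split => //.
  by apply: csmooth_extend0 cC CU _ sh rC => //; exact: smooth_smooth_on.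
by move=> q Vq; rewrite r1// mul1r.
Qed.

End CSmooth.

Lemma csmooth_on_comp (R : realType) (m n : nat) (F : manifold R m)
    (Z : manifold R n) (i : F -> Z) (U : set Z) (h : Z -> R[i]) :
  smooth_map i -> open U -> csmooth_on U h ->
  csmooth_on (i @^-1` U) (fun p => h (i p)).
Proof.
move=> si oU [hr hi].
by split; [exact: (smooth_on_comp si oU hr)|exact: (smooth_on_comp si oU hi)].
Qed.

(** * Derivations at a point *)

Section Tangent.
Variables (R : realType) (n : nat) (M : manifold R n) (p : M) (v : tvec M).
Hypothesis tv : tangent p v.
Implicit Types (f g : M -> R) (h k : M -> R[i]).

Let oT : open [set: M] := openT.

Lemma smooth_cst (c : R) : smooth (fun _ : M => c).
Proof. exact: (smooth_on_cst (M := M)). Qed.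

Lemma tangentM f g : smooth f -> smooth g ->
  v (fun q => f q * g q) = v f * g p + f p * v g.
Proof. by case: tv => _ + _; exact. Qed.

(** The Leibniz rule for [1 = 1 * 1] gives [v 1 = v 1 + v 1]. *)
Lemma tangent_cst (c : R) : v (fun=> c) = 0.
Proof.
have [lin _ _] := tv.
have v0 : v (fun=> 0) = 0.
  have := lin 1 (fun=> 0) (fun=> 0) (smooth_cst 0) (smooth_cst 0).
  under [X in v X]eq_fun do rewrite mulr0 addr0.
  rewrite mul1r.
  by move/eqP; rewrite -{1}[v _]addr0 (inj_eq (addrI _)) => /eqP <-.
have v1 : v (fun=> 1) = 0.
  have := tangentM (smooth_cst 1) (smooth_cst 1).
  under [X in v X]eq_fun do rewrite mulr1.
  rewrite mul1r mulr1.
  by move/eqP; rewrite -{1}[v _]addr0 (inj_eq (addrI _)) => /eqP <-.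
have := lin c (fun=> 1) (fun=> 0) (smooth_cst 1) (smooth_cst 0).
by rewrite v1 v0 mulr0 !addr0 mulr1.
Qed.

Lemma tangentD f g : smooth f -> smooth g ->
  v (fun q => f q + g q) = v f + v g.
Proof.
move=> sf sg; have [lin _ _] := tv.
rewrite -[in RHS](mul1r (v f)) -lin//; congr v.
by apply/funext => q; rewrite mul1r.
Qed.

Lemma tangentZ c f : smooth f -> v (fun q => c * f q) = c * v f.
Proof.
by move=> sf; rewrite (tangentM (smooth_cst c) sf) tangent_cst mul0r add0r.
Qed.

Lemma tangentN f : smooth f -> v (fun q => - f q) = - v f.
Proof.
move=> sf; rewrite -mulN1r -tangentZ//; congr v.
by apply/funext => q; rewrite mulN1r.
Qed.

Lemma tangentB f g : smooth f -> smooth g ->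
  v (fun q => f q - g q) = v f - v g.
Proof.
by move=> sf sg; rewrite (tangentD sf (smooth_onN oT sg)) tangentN.
Qed.

Lemma tangent_sum (I : Type) (r : seq I) (F : I -> M -> R) :
  (forall i, smooth (F i)) ->
  v (fun q => \sum_(i <- r) F i q) = \sum_(i <- r) v (F i).
Proof.
move=> sF; elim: r => [|i r IH].
  rewrite big_nil -[RHS](tangent_cst 0); congr v.
  by apply/funext => q; rewrite big_nil.
rewrite big_cons -IH -tangentD//; last exact: (smooth_on_sum _ oT sF).
by congr v; apply/funext => q; rewrite big_cons.
Qed.

(** With a bump [rho] supported in [U], the functions [rho * f] and [rho * g] are equal everywhere.
    In the Leibniz rule the terms with [v rho] agree because [f p = g p], and [rho p = 1] leaves
    [v f = v g]. *)
Lemma tangent_local U f g : open U -> U p -> smooth f -> smooth g ->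
  (forall q, U q -> f q = g q) -> v f = v g.
Proof.
move=> oU Up sf sg fg.
have [rho [C [V [[sr cC CU rC] [oV Vp VU r1]]]]] := bump oU Up.
have E : (fun q => rho q * f q) = (fun q => rho q * g q).
  apply/funext => q; have [/CU/fg->//|nC] := pselect (C q).
  by rewrite rC ?mul0r.
have := congr1 v E; rewrite !tangentM// (fg _ Up) => /addrI.
by rewrite r1// !mul1r.
Qed.

Lemma cderivD h k : csmooth h -> csmooth k ->
  cderiv v (fun q => h q + k q) = cderiv v h + cderiv v k.
Proof.
move=> [hr hi] [kr ki]; rewrite /cderiv; apply: complex_eq; rewrite ?ReImE /=.
- by rewrite -tangentD//; congr v; apply/funext => q; rewrite ReD.
- by rewrite -tangentD//; congr v; apply/funext => q; rewrite ImD.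
Qed.

Lemma cderivM h k : csmooth h -> csmooth k ->
  cderiv v (fun q => h q * k q) = cderiv v h * k p + h p * cderiv v k.
Proof.
move=> [hr hi] [kr ki]; rewrite /cderiv; apply: complex_eq; rewrite ?ReImE /=.
- under [X in v X]eq_fun do rewrite ReM.
  rewrite (tangentB (smooth_onM oT hr kr) (smooth_onM oT hi ki)) !tangentM//.
  ring.
- under [X in v X]eq_fun do rewrite ImM.
  rewrite (tangentD (smooth_onM oT hr ki) (smooth_onM oT hi kr)) !tangentM//.
  ring.
Qed.

Lemma cderiv_real f : cderiv v (fun q => Complex (f q) 0) = Complex (v f) 0.
Proof. by rewrite /cderiv /= tangent_cst. Qed.

Lemma cderiv_sum (I : Type) (r : seq I) (F : I -> M -> R[i]) :
  (forall i, csmooth (F i)) ->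
  cderiv v (fun q => \sum_(i <- r) F i q) = \sum_(i <- r) cderiv v (F i).
Proof.
move=> sF; elim: r => [|i r IH].
  rewrite big_nil /cderiv; under eq_fun do rewrite big_nil /=.
  by under [X in Complex _ (v X)]eq_fun do rewrite big_nil /=; rewrite tangent_cst.
rewrite big_cons -IH -(cderivD (sF i) (csmooth_on_sum r oT sF)).
by congr cderiv; apply/funext => q; rewrite big_cons.
Qed.

Lemma cderiv_local U h k : open U -> U p -> csmooth h -> csmooth k ->
  (forall q, U q -> h q = k q) -> cderiv v h = cderiv v k.
Proof.
move=> oU Up [hr hi] [kr ki] hk; rewrite /cderiv; congr Complex.
- by apply: (tangent_local oU Up hr kr) => q /hk ->.
- by apply: (tangent_local oU Up hi ki) => q /hk ->.
Qed.

End Tangent.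

(** * Line bundles *)

Section Bundle.
Variables (R : realType) (n : nat) (M : manifold R n) (C : line_bundle M).
Implicit Types (s e : csection C) (h : M -> R[i]) (t : trivialization C).

Let oT : open [set: M] := openT.

Section Fibre.
Variables (t : trivialization C) (p : M).
Hypothesis tp : tdom t p.

Lemma tmap0 : tmap t (0 : fiber C p) = 0.
Proof.
have := tmap_linear tp 1 0 0; rewrite scale1r addr0 mul1r.
by move/eqP; rewrite -{1}[tmap t 0]addr0 (inj_eq (addrI _)) => /eqP <-.
Qed.

Lemma tmapZ (c : R[i]) (x : fiber C p) : tmap t (c *: x) = c * tmap t x.
Proof. by rewrite -[c *: x]addr0 (tmap_linear tp) tmap0 addr0. Qed.

Lemma tmapD (x y : fiber C p) : tmap t (x + y) = tmap t x + tmap t y.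
Proof. by have := tmap_linear tp 1 x y; rewrite scale1r mul1r. Qed.

Lemma tmap_inj (x y : fiber C p) : tmap t x = tmap t y -> x = y.
Proof. by move/(bij_inj (tmap_bijective tp)). Qed.

Lemma tmap_eq0 (x : fiber C p) : (tmap t x == 0) = (x == 0).
Proof.
by apply/eqP/eqP => [|->]; [rewrite -tmap0 => /tmap_inj|exact: tmap0].
Qed.

End Fibre.

Lemma smooth_csection_local s :
  (forall p, exists V (s' : csection C), [/\ open V, V p, smooth_csection s'
    & forall q, V q -> s q = s' q]) -> smooth_csection s.
Proof.
move=> H t; apply: csmooth_on_local => p tp.
have [V [s' [oV Vp ss' E]]] := H p.
have oVt : open (tdom t `&` V) by apply: openI => //; exact: open_tdom.
exists (tdom t `&` V); split => //.
apply: (csmooth_on_eq (h := fun q => tmap t (s' q))) => //.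
  by move=> q [_ Vq]; rewrite E.
by apply: csmooth_on_sub (ss' t) => q [].
Qed.

Lemma smooth_csectionZ h s : csmooth h -> smooth_csection s ->
  smooth_csection (fun q => h q *: s q).
Proof.
move=> sh ss t.
apply: (csmooth_on_eq (h := fun q => h q * tmap t (s q))).
- exact: open_tdom.
- by move=> q tq; rewrite tmapZ.
- exact: (csmooth_onM (open_tdom t) (csmooth_on_sub (@subsetT _ _) sh) (ss t)).
Qed.

(** In a trivialization [h] is the quotient of the two coordinates, smooth where [e] does not
    vanish, then extended to a global function with the same germ at [p]. *)
Lemma section_coef p e s : smooth_csection e -> smooth_csection s -> e p != 0 ->
  exists h (V : set M), [/\ csmooth h, open V, V p
    & forall q, V q -> s q = h q *: e q /\ e q != 0].
Proof.
move=> se ss ep0; have [t tp] := cover_tdom C p.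
have [er ei] := se t.
(* The squared modulus is a real smooth function, so its continuity shows that the set where [e]
   does not vanish is open. *)
pose N q := complex.Re (tmap t (e q)) ^+ 2 + complex.Im (tmap t (e q)) ^+ 2.
have N0 q : tdom t q -> (N q != 0) = (e q != 0).
  move=> tq; rewrite -(tmap_eq0 tq) /N paddr_eq0 ?sqr_ge0// !sqrf_eq0.
  by congr (~~ _); case: (tmap t (e q)) => a b; rewrite eq_complex.
have sN : smooth_on (tdom t) N.
  exact: (smooth_onD (open_tdom t) (smooth_onM (open_tdom t) er er)
    (smooth_onM (open_tdom t) ei ei)).
pose U := [set q | tdom t q /\ N q != 0].
have oU : open U.
  rewrite openE => q [tq Nq]; rewrite /interior.
  have h1 := open_nbhs_nbhs (conj (open_tdom t) tq).
  have h2 : nbhs q (N @^-1` [set x | x != 0]).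
    apply: (smooth_on_continuous tq (open_tdom t) sN).
    by apply: open_nbhs_nbhs; split => //; exact: open_neq.
  by apply: filterS2 h1 h2 => r tr Nr; split.
have Up : U p by split => //; rewrite N0.
have sh : csmooth_on U (fun q => tmap t (s q) * (tmap t (e q))^-1).
  have sUt (k : M -> R[i]) : csmooth_on (tdom t) k -> csmooth_on U k.
    by apply: csmooth_on_sub => q [].
  apply: (csmooth_onM oU (sUt _ (ss t)) (csmooth_onV oU _ (sUt _ (se t)))).
  by move=> q [tq]; rewrite N0// tmap_eq0.
have [h [V [sh' oV Vp VU E]]] := csmooth_extend oU Up sh.
exists h, V; split => // q Vq; have [tq Nq] := VU _ Vq.
have eq0 : e q != 0 by rewrite -N0.
split => //; apply: (tmap_inj tq).
by rewrite (tmapZ tq) E// divfK// (tmap_eq0 tq).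
Qed.

Lemma nonvanishing_section p :
  exists e : csection C, smooth_csection e /\ e p != 0.
Proof.
have [t tp] := cover_tdom C p.
have [rho [K [V [[sr cK KU rK] [oV Vp VU r1]]]]] := bump (open_tdom t) tp.
(* The unit section of the trivialization; its values outside [tdom t] are immaterial since [rho]
   vanishes there. *)
pose u q : fiber C q := xget 0 [set x | tmap t x = 1].
have uE q : tdom t q -> tmap t (u q) = 1.
  move=> tq; rewrite /u; case: xgetP => // H.
  by have [g _ gK] := tmap_bijective tq; have := H (g 1); rewrite /= gK.
pose e q := Complex (rho q) 0 *: u q.
exists e; split; last first.
  rewrite /e r1// scale1r -(tmap_eq0 tp) uE//; exact: oner_neq0.
move=> t'; apply: csmooth_on_local => q t'q.
have [tq|nq] := pselect (tdom t q).
  have oI : open (tdom t `&` tdom t') by apply: openI; exact: open_tdom.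
  have [g sg gE] := tmap_transition t t'.
  exists (tdom t `&` tdom t'); split => //.
  apply: (csmooth_on_eq (h := fun r => g r * Complex (rho r) 0)) => //.
    by move=> r [tr t'r]; rewrite (gE _ tr t'r) (tmapZ tr) uE// mulr1.
  apply: (csmooth_onM oI sg).
  by apply: csmooth_on_real; exact: smooth_smooth_on.
exists (tdom t' `&` ~` K); split; last 2 first.
- by split => // /KU.
- apply: (csmooth_on_eq (h := fun=> 0)); last exact: csmooth_on_cst.
    by apply: openI; [exact: open_tdom|exact: closed_openC].
  by move=> r [t'r Kr]; rewrite /e rK// scale0r tmap0.
- by apply: openI; [exact: open_tdom|exact: closed_openC].
Qed.

End Bundle.

(** * Pull-back of a line bundle *)

Section Pullback.
Variables (R : realType) (m n : nat) (F : manifold R m) (Z : manifold R n).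
Variables (i : F -> Z) (si : smooth_map i) (C : line_bundle Z).

(** Closed by [Defined], so that the fibre at [p] is convertible to [fiber C (i p)] and [e (i p)]
    can be used as an element of it. *)
Definition pullback_bundle : line_bundle F.
Proof.
refine (@LineBundle R m F (fun p => fiber C (i p)) (trivialization C)
  (fun t => i @^-1` tdom t) (fun t p x => tmap t x) _ _ _ _ _).
- move=> t; apply: open_comp => [q _|]; [exact: si.1|exact: open_tdom].
- by move=> p; exact: cover_tdom.
- by move=> t p tp; exact: tmap_linear.
- by move=> t p tp; exact: tmap_bijective.
- move=> t t'; have [g sg gE] := tmap_transition t t'.
  exists (fun p => g (i p)).
    apply: (csmooth_on_comp si _ sg); apply: openI; exact: open_tdom.
  by move=> p; exact: gE.
Defined.

Lemma smooth_pullback_section (s : csection C) : smooth_csection s ->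
  @smooth_csection _ _ _ pullback_bundle (fun p => s (i p)).
Proof.
move=> ss t; exact: (csmooth_on_comp si (@open_tdom _ _ _ C t) (ss t)).
Qed.

End Pullback.

(** * Frames of a distribution *)

Lemma smooth_on_det (R : realType) (n : nat) (M : manifold R n) (U : set M)
    (k : nat) (A : M -> 'M[R]_k) :
  open U -> (forall i j, smooth_on U (fun p => A p i j)) ->
  smooth_on U (fun p => \det (A p)).
Proof.
move=> oU sA; rewrite /determinant; apply: (smooth_on_sum _ oU) => s.
have sP := smooth_on_prod (index_enum 'I_k) oU (fun i => sA i (s i)).
exact: (smooth_onM oU (@smooth_on_cst _ _ M U _) sP).
Qed.

Lemma smooth_on_adj (R : realType) (n : nat) (M : manifold R n) (U : set M)
    (k : nat) (A : M -> 'M[R]_k) :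
  open U -> (forall i j, smooth_on U (fun p => A p i j)) ->
  forall i j, smooth_on U (fun p => (\adj (A p)) i j).
Proof.
move=> oU sA i j; under eq_fun do rewrite mxE.
rewrite /cofactor.
have sm i' j' : smooth_on U (fun p => row' j (col' i (A p)) i' j').
  by under eq_fun do rewrite !mxE; exact: sA.
exact: (smooth_onM oU (@smooth_on_cst _ _ M U _) (smooth_on_det oU sm)).
Qed.

Section Tvec.
Variables (R : realType) (n : nat) (M : manifold R n).
Implicit Types (p : M) (u v : tvec M).

Let oT : open [set: M] := openT.

Lemma tangent_lin p (c : R) u v : tangent p u -> tangent p v ->
  tangent p (fun f => c * u f + v f).
Proof.
move=> [ul um u0] [vl vm v0]; split.
- by move=> d f g sf sg; rewrite ul// vl//; ring.
- by move=> f g sf sg; rewrite um// vm//; ring.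
- by move=> f nf; rewrite u0// v0// mulr0 addr0.
Qed.

Lemma tangent_zero p : tangent p (fun=> 0).
Proof. by split => *; rewrite ?(mulr0, mul0r, addr0). Qed.

Lemma tangent_lincomb p (I : Type) (r : seq I) (X : I -> tvec M) (c : I -> R) :
  (forall j, tangent p (X j)) ->
  tangent p (fun f => \sum_(j <- r) c j * X j f).
Proof.
move=> tX; elim: r => [|j r IH].
  under eq_fun do rewrite big_nil; exact: tangent_zero.
by under eq_fun do rewrite big_cons; exact: (tangent_lin _ (tX j) IH).
Qed.

(** Among the matrices [Y_j (f_l)] of finite families of smooth functions, one of maximal rank has
    full column rank; otherwise a test function detecting a combination of the [Y_j] that kills the
    family could be appended. A left inverse of the matrix then yields the dual functions. *)
Lemma dual_functions p k (Y : 'I_k -> tvec M) :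
  (forall j, tangent p (Y j)) ->
  (forall c, lincomb Y c = (fun=> 0) -> forall j, c j = 0) ->
  exists f : 'I_k -> M -> R, (forall l, smooth (f l)) /\
    forall j l, Y j (f l) = (j == l)%:R.
Proof.
move=> tY liY.
pose mat m (f : 'I_m -> M -> R) : 'M[R]_(m, k) := \matrix_(l, j) Y j (f l).
pose P (r : nat) := `[< exists m (f : 'I_m -> M -> R), (forall l, smooth (f l)) /\
  \rank (mat m f) = r >].
have P0 : exists r, P r.
  exists (\rank (mat 0 (fun _ _ => 0))); apply/asboolP.
  by exists 0%N, (fun _ _ => 0); split => // -[].
have Pk r : P r -> (r <= k)%N.
  by move=> /asboolP[m [f [_ <-]]]; exact: rank_leq_col.
case: (ex_maxnP P0 Pk) => r /asboolP[m [f [sf rf]]] rmax.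
have full : row_full (mat m f).
  apply/negPn/negP; rewrite /row_full rf => rk.
  have ck0 : cokermx (mat m f) != 0.
    rewrite -mxrank_eq0 mxrank_coker rf subn_eq0 -ltnNge ltn_neqAle rk /=.
    by rewrite -rf rank_leq_col.
  have [a [b cab]] : exists a b, cokermx (mat m f) a b != 0.
    apply: contrapT => H; move/eqP: ck0; apply; apply/matrixP => a b.
    rewrite [RHS]mxE; apply/eqP; apply: contrapT => h; apply: H.
    by exists a, b; apply/negP.
  (* A nonzero column of the cokernel: the vector with coefficients [c] annihilates every [f l], but
     by independence it is not the zero vector. *)
  pose c j := cokermx (mat m f) j b.
  have [g gc] : exists g, lincomb Y c g != 0.
    apply: contrapT => H; move/eqP: cab; apply; apply: (liY c).
    apply/funext => g; apply/eqP; apply: contrapT => h; apply: H.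
    by exists g; apply/negP.
  (* Tangent vectors are normalized to 0 at non-smooth functions, so a function on which a
     combination of them is nonzero is smooth. *)
  have sg : smooth g.
    apply: contrapT => ng; move/eqP: gc; apply; rewrite /lincomb big1// => j _.
    by have [_ _ ->//] := tY j; rewrite mulr0.
  pose f' (l : 'I_(m + 1)%N) : M -> R := match fintype.split l with inl l' => f l' | inr _ => g end.
  have matE : mat (m + 1)%N f' = col_mx (mat m f) (\row_j Y j g).
    apply/matrixP => l j; rewrite !mxE /f'; case: (fintype.split l) => l'; by rewrite !mxE.
  have Pr : P (\rank (mat (m + 1)%N f')).
    apply/asboolP; exists (m + 1)%N, f'; split => // l.
    by rewrite /f'; case: (fintype.split l).
  have := rmax _ Pr; rewrite matE leqNgt => /negP; apply.
  have sub : (mat m f <= col_mx (mat m f) (\row_j Y j g))%MS.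
    by rewrite -addsmxE addsmxSl.
  rewrite -rf; apply: (rank_ltmx (A := mat m f)); rewrite ltmxE sub /=.
  apply/negP => sub2.
  (* If the rank did not grow, the row of [g] would lie in the row space of the old matrix and hence
     be killed by [c], contrary to the choice of [g]. *)
  have : ((\row_j Y j g) <= mat m f)%MS.
    apply: submx_trans sub2.
    by rewrite -addsmxE addsmxSr.
  rewrite submxE => /eqP/matrixP/(_ ord0 b); rewrite !mxE => e0.
  move/eqP: gc; apply; rewrite -[RHS]e0 /lincomb; apply: eq_bigr => j _.
  by rewrite mxE mulrC.
have /row_fullP[B BA] := full.
exists (fun l q => \sum_(a < m) B l a * f a q); split.
  move=> l; apply: (smooth_on_sum _ oT) => a.
  exact: (smooth_onM oT (@smooth_on_cst _ _ M setT _) (sf a)).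
move=> j l; have /matrixP/(_ l j) := BA; rewrite !mxE eq_sym => <-.
rewrite (tangent_sum (tY j)); last first.
  by move=> a; exact: (smooth_onM oT (@smooth_on_cst _ _ M setT _) (sf a)).
by apply: eq_bigr => a _; rewrite (tangentZ (tY j))// mxE.
Qed.

End Tvec.

Lemma open_bigcap_fin (T : topologicalType) (I : finType) (V : I -> set T) :
  (forall j, open (V j)) -> open (\bigcap_j V j).
Proof.
move=> oV; rewrite openE => q Vq; rewrite /interior.
apply: filterS (@filter_forall _ _ V (nbhs q) (nbhs_filter q) _).
  by move=> r Vr j _; exact: Vr.
by move=> j; apply: open_nbhs_nbhs; split => //; exact: Vq.
Qed.

Section Frames.
Variables (R : realType) (n k : nat) (M : manifold R n).
Variables (D : tangent_distribution M) (sD : smooth_distribution k D).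
Implicit Types (p : M) (u v : tvec M) (X Y : vfield M).

Let oT : open [set: M] := openT.

(** The fields are global sections, so that [nabla] can be applied to them; only on [U] do they form
    a basis. *)
Definition frame_on (U : set M) (Y : 'I_k -> vfield M) : Prop :=
  (forall j, section_of D (Y j)) /\
  forall q, U q ->
    (forall c, lincomb (Y^~ q) c = (fun=> 0) -> forall j, c j = 0) /\
    D q = range (lincomb (Y^~ q)).

Lemma distribution_lin p (c : R) u v : D p u -> D p v ->
  D p (fun f => c * u f + v f).
Proof.
have [U [X [_ Up _ /(_ p Up)[_ ->]]]] := sD p.
move=> [a _ <-] [b _ <-]; exists (fun j => c * a j + b j) => //.
apply/funext => f; rewrite /lincomb mulr_sumr -big_split /=.
by apply: eq_bigr => j _; rewrite mulrDl mulrA.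
Qed.

Lemma distribution_zero p : D p (fun=> 0).
Proof.
have [U [X [_ Up _ /(_ p Up)[_ ->]]]] := sD p.
exists (fun=> 0) => //; apply/funext => f.
by rewrite /lincomb big1// => j _; rewrite mul0r.
Qed.

Lemma section_tangent X p : section_of D X -> tangent p (X p).
Proof. by move=> [[tX _] _]; exact: tX. Qed.

Lemma section_smooth X f : section_of D X -> smooth f -> smooth (fun p => X p f).
Proof. by move=> [[_ sX] _]; exact: sX. Qed.

Lemma section_lin (f : M -> R) X Y : smooth f -> section_of D X ->
  section_of D Y -> section_of D (fun q g => f q * X q g + Y q g).
Proof.
move=> sf hX hY; split; first split.
- by move=> p _; apply: tangent_lin; exact: section_tangent.
- move=> g sg.
  exact: (smooth_onD oT (smooth_onM oT sf (section_smooth hX sg)) (section_smooth hY sg)).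
- by move=> p; apply: distribution_lin; [exact: hX.2|exact: hY.2].
Qed.

Lemma section_zero : section_of D (fun _ _ => 0).
Proof.
split; first split.
- by move=> p _; exact: tangent_zero.
- by move=> g sg; exact: smooth_cst.
- by move=> p; exact: distribution_zero.
Qed.

Lemma section_sum (I : Type) (r : seq I) (c : I -> M -> R) (X : I -> vfield M) :
  (forall j, smooth (c j)) -> (forall j, section_of D (X j)) ->
  section_of D (fun q g => \sum_(j <- r) c j q * X j q g).
Proof.
move=> sc sX; elim: r => [|j r IH].
  rewrite (_ : (fun _ _ => _) = fun _ _ => 0); first exact: section_zero.
  by apply/funext => q; apply/funext => g; rewrite big_nil.
rewrite (_ : (fun _ _ => _) = (fun q g => c j q * X j q g +
    \sum_(j0 <- r) c j0 q * X j0 q g)); first exact: section_lin.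
by apply/funext => q; apply/funext => g; rewrite big_cons.
Qed.

(** The local frame is multiplied by a bump function, which leaves it unchanged where the bump is
    1. *)
Lemma local_frame p : exists (U : set M) (Y : 'I_k -> vfield M),
  [/\ open U, U p & frame_on U Y].
Proof.
have [U [X [oU Up sX XD]]] := sD p.
have [rho [C [V [[sr cC CU rC] [oV Vp VU r1]]]]] := bump oU Up.
have rX j q : rho q <> 0 -> U q by move=> rq; apply: CU; apply: contrapT => /rC.
pose Y j : vfield M := fun q f => rho q * X j q f.
have YV q : V q -> (Y^~ q) = (X^~ q).
  by move=> Vq; apply/funext => j; apply/funext => f; rewrite /Y r1// mul1r.
exists V, Y; split => //; split; last first.
  by move=> q Vq; rewrite YV//; apply: XD; exact: VU.
move=> j; split; first split.
- move=> q _; have [Uq|nUq] := pselect (U q).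
    have -> : Y j q = (fun f => rho q * X j q f + (fun=> 0) f).
      by apply/funext => f; rewrite addr0.
    by apply: tangent_lin; [exact: (sX j).1|exact: tangent_zero].
  rewrite (_ : Y j q = fun=> 0); first exact: tangent_zero.
  by apply/funext => f; rewrite /Y rC ?mul0r// => /CU.
- move=> f sf.
  exact: (smooth_extend0 oU cC CU (smooth_smooth_on U sr) ((sX j).2 f sf) rC).
- move=> q; have [Uq|nUq] := pselect (U q).
    have [_ ->] := XD q Uq; exists (fun l => if l == j then rho q else 0) => //.
    apply/funext => f; rewrite /lincomb (bigD1 j)//= eqxx big1 ?addr0//.
    by move=> l /negbTE ->; rewrite mul0r.
  rewrite (_ : Y j q = fun=> 0); first exact: distribution_zero.
  by apply/funext => f; rewrite /Y rC ?mul0r// => /CU.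
Qed.

End Frames.

(** Evaluating [i_* X = \sum_j c_j Y_j] at the functions [f l] dual to the frame at [i p] gives the
    linear system [b = c A]. Its matrix is the identity at [p], hence invertible nearby, and its
    entries are smooth. *)
Lemma frame_coef (R : realType) (m n k : nat) (F : manifold R m)
    (Z : manifold R n) (D : tangent_distribution Z) (U : set Z)
    (Y : 'I_k -> vfield Z) (i : F -> Z) (X : vfield F) (p : F) :
  open U -> frame_on D U Y -> smooth_map i -> U (i p) ->
  smooth_vfield_on [set: F] X -> (forall q, D (i q) (pushforward i (X q))) ->
  exists (c : 'I_k -> F -> R) (V : set F),
  [/\ forall j, smooth (c j), open V, V p, V `<=` i @^-1` U
    & forall q, V q -> pushforward i (X q) = lincomb (Y^~ (i q)) (c^~ q)].
Proof.
move=> oU [sY YD] si Up [tX sX] XD.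
have tY j : tangent (i p) (Y j (i p)) by exact: (sY j).1.1.
have [f [sf Yf]] := dual_functions tY (YD _ Up).1.
pose A q : 'M[R]_k := \matrix_(j, l) Y j (i q) (f l).
have oT : open [set: F] by exact: openT.
have sA j l : smooth (fun q => A q j l).
  under eq_fun do rewrite mxE.
  exact: (smooth_on_comp si openT ((sY j).1.2 (f l) (sf l))).
have sdA := smooth_on_det oT sA.
pose V0 := (fun q => \det (A q)) @^-1` [set x | x != 0].
have oV0 : open V0.
  apply: open_comp; last exact: open_neq.
  by move=> q _; exact: (smooth_on_continuous (U := setT) I oT sdA).
have V0p : V0 p.
  rewrite /V0 /= (_ : A p = 1%:M) ?det1 ?oner_neq0//.
  by apply/matrixP => j l; rewrite !mxE Yf.
pose b q : 'rV[R]_k := \row_l X q (fun r => f l (i r)).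
pose W := V0 `&` i @^-1` U.
have oW : open W.
  by apply: openI => //; apply: open_comp => // q _; exact: si.1.
have sb l : smooth (fun q => b q ord0 l).
  by under eq_fun do rewrite mxE; apply: sX; exact: (smooth_on_comp si openT (sf l)).
have sc j : smooth_on W (fun q => (\det (A q))^-1 * (b q *m \adj (A q)) ord0 j).
  have dn q : W q -> \det (A q) != 0 by case.
  have sV := smooth_onV oW dn (smooth_smooth_on W sdA).
  have sl l : smooth_on W (fun q => b q ord0 l * (\adj (A q)) l j) :=
    smooth_onM oW (smooth_smooth_on W (sb l))
      (smooth_smooth_on W (smooth_on_adj oT sA l j)).
  have sS : smooth_on W (fun q => (b q *m \adj (A q)) ord0 j).
    by under eq_fun do rewrite mxE; exact: (smooth_on_sum _ oW sl).
  exact: (smooth_onM oW sV sS).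
(* Cramer's formula is smooth on [W] only; each coefficient is replaced by a global function with
   the same germ at [p]. *)
have ext j : exists (g : F -> R), smooth g /\ exists V : set F,
    [/\ open V, V p, V `<=` W & forall q, V q ->
      g q = (\det (A q))^-1 * (b q *m \adj (A q)) ord0 j].
  have [g [V [sg oV Vp VW E]]] := smooth_extend oW (conj V0p Up) (sc j).
  by exists g; split => //; exists V.
have [c cE] := choice ext.
have [V VE] := choice (fun j => (cE j).2).
pose V1 := W `&` \bigcap_(j in [set: 'I_k]) V j.
exists c, V1; split.
- by move=> j; case: (cE j).
- by apply: openI => //; apply: open_bigcap_fin => j; have [] := VE j.
- by split => // j _; have [] := VE j.
- by move=> q [[_ Uq] _].
move=> q [[Dq Uq] Vq].
have := XD q; have [_ ->] := YD _ Uq => -[a _ aE].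
(* Membership in [D] provides some coefficients [a]; they solve the system, so Cramer's formula
   returns them. *)
have bE : b q = (\row_j a j) *m A q.
  apply/rowP => l; rewrite !mxE.
  transitivity (pushforward i (X q) (f l)).
    by rewrite /pushforward; case: asboolP.
  by rewrite -aE /lincomb; apply: eq_bigr => j _; rewrite !mxE.
rewrite -aE; congr lincomb; apply/funext => j.
have [_ _ _ ->] := VE j; last exact: Vq.
rewrite bE -mulmxA mul_mx_adj mul_mx_scalar !mxE mulrA mulVf ?mul1r//.
Qed.

(** * Locality and tensoriality of leafwise connections *)

Section Connection.
Variables (R : realType) (n k : nat) (Z : manifold R n).
Variables (D : tangent_distribution Z) (sD : smooth_distribution k D).
Variables (C : line_bundle Z) (nabla : vfield Z -> csection C -> csection C).
Hypothesis hN : leafwise_connection D nabla.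
Implicit Types (X Y : vfield Z) (s e : csection C).

Let oT : open [set: Z] := openT.

Lemma nabla_smooth X s : section_of D X -> smooth_csection s ->
  smooth_csection (nabla X s).
Proof. by case: hN => + _ _ _; exact. Qed.

Lemma nabla_field_lin (f : Z -> R) X Y s p : smooth f ->
  section_of D X -> section_of D Y -> smooth_csection s ->
  nabla (fun q g => f q * X q g + Y q g) s p
  = Complex (f p) 0 *: nabla X s p + nabla Y s p.
Proof. by case: hN => _ + _ _ sf sX sY ss; apply. Qed.

Lemma nablaZ (h : Z -> R[i]) X s p : csmooth h -> section_of D X ->
  smooth_csection s ->
  nabla X (fun q => h q *: s q) p = cderiv (X p) h *: s p + h p *: nabla X s p.
Proof. by case: hN => _ _ _ + sh sX ss; apply. Qed.

Lemma nabla_field_zero s p : smooth_csection s -> nabla (fun _ _ => 0) s p = 0.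
Proof.
move=> ss; have z := section_zero sD.
have := nabla_field_lin p (@smooth_cst _ _ Z 1) z z ss.
have -> : (fun (_ : Z) (_ : Z -> R) => 1 * 0 + 0 : R) = fun _ _ => 0.
  by apply/funext => q; apply/funext => g; rewrite mulr0 addr0.
rewrite (_ : Complex 1 0 = 1) ?scale1r; last by [].
move=> /eqP.
by rewrite -{1}[nabla _ s p]addr0 (inj_eq (addrI _)) => /eqP <-.
Qed.

Lemma nabla_field_sum (I : Type) (r : seq I) (c : I -> Z -> R)
    (X : I -> vfield Z) s p :
  (forall j, smooth (c j)) -> (forall j, section_of D (X j)) ->
  smooth_csection s ->
  nabla (fun q g => \sum_(j <- r) c j q * X j q g) s p
  = \sum_(j <- r) Complex (c j p) 0 *: nabla (X j) s p.
Proof.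
move=> sc sX ss; elim: r => [|j r IH].
  rewrite big_nil -[RHS](nabla_field_zero p ss); congr (nabla _ s p).
  by apply/funext => q; apply/funext => g; rewrite big_nil.
rewrite big_cons -IH -nabla_field_lin//; last exact: section_sum.
congr (nabla _ s p).
by apply/funext => q; apply/funext => g; rewrite big_cons.
Qed.

(** The argument of [tangent_local]: [rho *: s] and [rho *: s'] are the same global section, and the
    derivative terms of the Leibniz rule cancel since [s p = s' p]. *)
Lemma nabla_local V X s s' p : open V -> V p -> section_of D X ->
  smooth_csection s -> smooth_csection s' ->
  (forall q, V q -> s q = s' q) -> nabla X s p = nabla X s' p.
Proof.
move=> oV Vp sX ss ss' E.
have [rho [K [W [[sr cK KV rK] [oW Wp WV r1]]]]] := bump oV Vp.
have sr' : csmooth (fun q => Complex (rho q) 0) := csmooth_on_real sr.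
have EE : (fun q => Complex (rho q) 0 *: s q) = (fun q => Complex (rho q) 0 *: s' q).
  apply/functional_extensionality_dep => q.
  have [/KV/E->//|nK] := pselect (K q).
  by rewrite rK// !scale0r.
have := congr1 (fun s => nabla X s p) EE.
by rewrite !nablaZ// (E _ Vp) => /addrI; rewrite r1// !scale1r.
Qed.

(** This lets [frame_coef], stated for a map [i], expand sections of [D] on [Z] itself. *)
Lemma pushforward_id p v : tangent p v -> pushforward (@id Z) v = v.
Proof.
move=> [_ _ v0]; apply/funext => f; rewrite /Defs.pushforward.
by case: asboolP => // /v0.
Qed.

(** In a frame the difference [W = Y - X] has coefficients vanishing at [p], and [nabla] is linear
    over functions in the field. *)
Lemma nabla_tensor X Y s p : section_of D X -> section_of D Y ->
  smooth_csection s -> X p = Y p -> nabla X s p = nabla Y s p.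
Proof.
move=> sX sY ss XY.
pose W : vfield Z := fun q g => -1 * X q g + Y q g.
have sW : section_of D W := section_lin sD (@smooth_cst _ _ Z (-1)) sX sY.
have [U [E [oU Up fE]]] := local_frame sD p.
have WD q : D q (pushforward id (W q)).
  by rewrite (pushforward_id (section_tangent q sW)); exact: sW.2.
have [c [V [sc oV Vp VU cE]]] := frame_coef oU fE (smooth_map_id Z) Up sW.1 WD.
have c0 j : c j p = 0.
  apply: ((fE.2 _ Up).1 (c^~ p)).
  rewrite -(cE _ Vp) (pushforward_id (section_tangent p sW)).
  by apply/funext => g; rewrite /W XY mulN1r addNr.
have [rho [K [V' [[sr cK KV rK] [oV' Vp' V'V r1]]]]] := bump oV Vp.
have src j : smooth (fun q => rho q * c j q) := smooth_onM oT sr (sc j).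
(* The expansion of [W] holds on [V] only; multiplied by [rho] it becomes an identity of global
   fields. The [+ 0] gives the left side the shape of the linearity axiom. *)
have EE : (fun q g => rho q * W q g + 0) =
    (fun q g => \sum_j (rho q * c j q) * E j q g).
  apply/funext => q; apply/funext => g; rewrite addr0.
  have [Kq|nK] := pselect (K q); last first.
    by rewrite rK// mul0r big1// => j _; rewrite !mul0r.
  rewrite -(pushforward_id (section_tangent q sW)) cE; last exact: KV.
  by rewrite /lincomb mulr_sumr; apply: eq_bigr => j _; rewrite mulrA.
have := congr1 (fun X => nabla X s p) EE.
rewrite (nabla_field_lin p sr sW (section_zero sD) ss) nabla_field_zero// addr0.
rewrite (nabla_field_sum _ _ src fE.1 ss) r1// scale1r big1; last first.
  by move=> j _; rewrite c0 mulr0 scale0r.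
rewrite (nabla_field_lin p (@smooth_cst _ _ Z (-1)) sX sY ss).
rewrite (_ : Complex (-1) 0 = -1); last by apply: complex_eq; rewrite ?ReImE /= ?oppr0.
by rewrite scaleN1r addrC => /eqP; rewrite subr_eq0 => /eqP.
Qed.

End Connection.

(** * The pulled back connection *)

Lemma cderiv_lincomb (R : realType) (n : nat) (M : manifold R n) (I : Type)
    (r : seq I) (c : I -> R) (X : I -> tvec M) (h : M -> R[i]) :
  cderiv (fun f => \sum_(j <- r) c j * X j f) h
  = \sum_(j <- r) Complex (c j) 0 * cderiv (X j) h.
Proof.
elim: r => [|j r IH]; first by rewrite big_nil /cderiv !big_nil.
rewrite big_cons -IH; apply: complex_eq; rewrite ?ReImE /= big_cons.
  by rewrite mul0r subr0.
by rewrite mul0r addr0.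
Qed.

Lemma scaler_injl (K : fieldType) (V : lmodType K) (x : V) (a b : K) :
  x != 0 -> a *: x = b *: x -> a = b.
Proof.
move=> x0 /eqP; rewrite -subr_eq0 -scalerBl scaler_eq0 (negbTE x0) orbF.
by rewrite subr_eq0 => /eqP.
Qed.

Section PullConnection.
Variables (R : realType) (m n k : nat) (F : manifold R m) (Z : manifold R n).
Variables (D : tangent_distribution Z) (sD : smooth_distribution k D).
Variables (C : line_bundle Z) (nabla : vfield Z -> csection C -> csection C).
Hypothesis hN : leafwise_connection D nabla.
Variables (i : F -> Z) (si : smooth_map i).
Hypothesis iD : forall p v, tangent p v -> D (i p) (pushforward i v).

Local Notation PB := (pullback_bundle si C).
Implicit Types (e : csection C) (s : csection PB) (h : F -> R[i]).

Let oF : open [set: F] := openT.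

Lemma cderiv_pushforward (v : tvec F) (g : Z -> R[i]) : csmooth g ->
  cderiv (pushforward i v) g = cderiv v (fun q => g (i q)).
Proof.
by move=> [sr sI]; rewrite /cderiv /Defs.pushforward; do 2!case: asboolP => //.
Qed.

Lemma csmooth_pull (g : Z -> R[i]) : csmooth g -> csmooth (fun q => g (i q)).
Proof. exact: (csmooth_on_comp si openT). Qed.

Lemma section_through z u : D z u -> exists W, section_of D W /\ W z = u.
Proof.
have [U [Y [oU Uz [sY YD]]]] := local_frame sD z.
rewrite (YD _ Uz).2 => -[c _ <-].
exists (fun q g => \sum_j (c j) * Y j q g); split => //.
exact: (section_sum sD _ (fun j => @smooth_cst _ _ Z (c j)) sY).
Qed.

Definition pull_value (v : tvec F) p e h W : fiber C (i p) :=
  cderiv v h *: e (i p) + h p *: nabla W e (i p).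

(** The Leibniz rule for [g] on [Z] matches the one for the product of [h] and [g \o i] on [F],
    because [W (i p) = i_* v] gives [W g = v (g \o i)] at [i p]. *)
Lemma pull_value_rescale v p e e0 h g W (G : set Z) :
  tangent p v -> smooth_csection e -> smooth_csection e0 -> csmooth h ->
  csmooth g -> section_of D W -> W (i p) = pushforward i v ->
  open G -> G (i p) -> (forall z, G z -> e z = g z *: e0 z) ->
  pull_value v p e h W = pull_value v p e0 (fun q => h q * g (i q)) W.
Proof.
move=> tv se se0 sh sg sW Wv oG Gp E; rewrite /pull_value.
rewrite (nabla_local hN oG Gp sW se (smooth_csectionZ sg se0) E).
rewrite (nablaZ hN) // (E _ Gp) Wv (cderiv_pushforward _ sg).
rewrite (cderivM tv sh (csmooth_pull sg)).
by rewrite scalerDr scalerDl !scalerA addrA [cderiv v h * _]mulrC.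
Qed.

(** Both [e] and [e'] may vanish at [i p], so they are not compared directly but expressed through a
    third section [e0] that does not. The resulting coefficients of [s] agree near [p], and so do
    their derivatives along [v]. *)
Lemma pull_value_unique v p s e h W V e' h' W' V' :
  tangent p v ->
  smooth_csection e -> csmooth h -> section_of D W ->
  W (i p) = pushforward i v -> open V -> V p ->
  (forall q, V q -> s q = h q *: e (i q)) ->
  smooth_csection e' -> csmooth h' -> section_of D W' ->
  W' (i p) = pushforward i v -> open V' -> V' p ->
  (forall q, V' q -> s q = h' q *: e' (i q)) ->
  pull_value v p e h W = pull_value v p e' h' W'.
Proof.
move=> tv se sh sW Wv oV Vp E se' sh' sW' Wv' oV' Vp' E'.
have [e0 [se0 e0p]] := nonvanishing_section C (i p).
have [g [G [sg oG Gp gE]]] := section_coef se0 se e0p.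
have [g' [G' [sg' oG' Gp' gE']]] := section_coef se0 se' e0p.
rewrite (pull_value_rescale tv se se0 sh sg sW Wv oG Gp (fun z Gz => (gE z Gz).1)).
rewrite (pull_value_rescale tv se' se0 sh' sg' sW' Wv' oG' Gp' (fun z Gz => (gE' z Gz).1)).
pose O := (V `&` V') `&` i @^-1` (G `&` G').
have oO : open O.
  apply: openI; first exact: openI.
  by apply: open_comp => [q _|]; [exact: si.1|exact: openI].
have HE q : O q -> h q * g (i q) = h' q * g' (i q).
  move=> [[Vq Vq'] [Gq Gq']]; apply: (scaler_injl (gE _ Gq).2).
  by rewrite -!scalerA -(gE _ Gq).1 -(gE' _ Gq').1 -E// -E'.
have Op : O p by [].
have s1 := csmooth_onM oF sh (csmooth_pull sg).
have s2 := csmooth_onM oF sh' (csmooth_pull sg').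
rewrite /pull_value (cderiv_local tv oO Op s1 s2 HE) (HE _ Op).
by rewrite (nabla_tensor sD hN sW sW' se0)// Wv Wv'.
Qed.

(** The value is characterized by all representations of [s] and [X p] at once, rather than computed
    from a chosen one. A single representation then determines it, by [pull_value_unique]. *)
Definition pull_nabla (X : vfield F) s : csection PB :=
  fun p => xget 0 [set y | forall e h W V,
    smooth_csection e -> csmooth h -> section_of D W ->
    W (i p) = pushforward i (X p) -> open V -> V p ->
    (forall q, V q -> s q = h q *: e (i q)) ->
    y = pull_value (X p) p e h W].

Lemma pull_nablaE X s p e h W V : tangent p (X p) ->
  smooth_csection e -> csmooth h -> section_of D W ->
  W (i p) = pushforward i (X p) -> open V -> V p ->
  (forall q, V q -> s q = h q *: e (i q)) ->
  pull_nabla X s p = pull_value (X p) p e h W.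
Proof.
move=> tX se sh sW WX oV Vp E; apply: xget_unique => /=.
  move=> e' h' W' V' se' sh' sW' WX' oV' Vp' E'.
  exact: pull_value_unique tX se sh sW WX oV Vp E se' sh' sW' WX' oV' Vp' E'.
by move=> y; apply; eassumption.
Qed.

Lemma pull_coef (p : F) s e : smooth_csection s -> smooth_csection e ->
  e (i p) != 0 -> exists h V, [/\ csmooth h, open V, V p
    & forall q, V q -> s q = h q *: e (i q)].
Proof.
move=> ss se ep.
have [h [V [sh oV Vp E]]] := section_coef (p := p) (smooth_pullback_section (si := si) se) ss ep.
by exists h, V; split => // q Vq; exact: (E q Vq).1.
Qed.

(** The [a j] are the components, in the frame [Y], of the connection form in the gauge [e]. *)
Definition local_data (G : set Z) (Y : 'I_k -> vfield Z) e (a : 'I_k -> Z -> R[i]) :=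
  [/\ open G, frame_on D G Y, smooth_csection e, forall j, csmooth (a j)
    & forall z, G z -> e z != 0 /\ forall j, nabla (Y j) e z = a j z *: e z].

Lemma exists_local_data z : exists G Y e a, G z /\ local_data G Y e a.
Proof.
have [U [Y [oU Uz fY]]] := local_frame sD z.
have [e [se ez]] := nonvanishing_section C z.
have H j : exists ja : Z -> R[i], csmooth ja /\ exists V : set Z, [/\ open V, V z &
    forall q, V q -> nabla (Y j) e q = ja q *: e q /\ e q != 0].
  have [h [V [sh oV Vp E]]] := section_coef se (nabla_smooth hN (fY.1 j) se) ez.
  by exists h; split => //; exists V.
have [a aE] := choice H.
have [V VE] := choice (fun j => (aE j).2).
(* Applied to [e] itself only to get a neighbourhood where [e] does not vanish: for [k = 0] the
   intersection of the [V j] is the whole space. *)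
have [h [V0 [_ oV0 V0z E0]]] := section_coef se se ez.
exists ((U `&` V0) `&` \bigcap_j V j), Y, e, a; split.
  by split => // j _; have [] := VE j.
split => //.
- apply: openI; first exact: openI.
  by apply: open_bigcap_fin => j; have [] := VE j.
- by split; [exact: fY.1|move=> q [[Uq _] _]; exact: fY.2].
- by move=> j; have [] := aE j.
move=> q [[_ /E0[_ eq0]] Vq]; split => // j.
by have [_ _ H'] := VE j; exact: (H' q (Vq j I)).1.
Qed.

Definition conn_form (a : 'I_k -> Z -> R[i]) (c : 'I_k -> F -> R) (q : F) : R[i] :=
  \sum_j Complex (c j q) 0 * a j (i q).

Lemma csmooth_conn_form a c : (forall j, csmooth (a j)) ->
  (forall j, smooth (c j)) -> csmooth (conn_form a c).
Proof.
move=> sa sc; apply: (csmooth_on_sum _ oF) => j.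
exact: (csmooth_onM oF (csmooth_on_real (sc j)) (csmooth_pull (sa j))).
Qed.

Lemma pull_nabla_local G Y e a X s h V c q :
  local_data G Y e a -> tangent q (X q) -> csmooth h -> open V -> V q ->
  G (i q) -> (forall r, V r -> s r = h r *: e (i r)) ->
  pushforward i (X q) = lincomb (Y^~ (i q)) (c^~ q) ->
  pull_nabla X s q = (cderiv (X q) h + h q * conn_form a c q) *: e (i q).
Proof.
move=> [oG fY se sa aE] tX sh oV Vq Gq E cE.
have sc j : smooth (fun _ : Z => c j q) by exact: smooth_cst.
(* The extension of [i_* (X q)] to [Z] is the frame combination with the constants [c j q]. *)
have sW := section_sum sD (index_enum 'I_k) sc fY.1.
rewrite (pull_nablaE tX se sh sW _ oV Vq E)//.
rewrite /pull_value (nabla_field_sum sD hN _ _ sc fY.1 se) scalerDl; congr (_ + _).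
rewrite -scalerA; congr (_ *: _); rewrite /conn_form scaler_suml.
by apply: eq_bigr => j _; rewrite ((aE _ Gq).2 j) scalerA.
Qed.

Lemma csmooth_cderiv (X : vfield F) h : smooth_vfield_on [set: F] X -> csmooth h ->
  csmooth (fun q => cderiv (X q) h).
Proof. by move=> [_ sX] [hr hi]; split; apply: sX. Qed.

Lemma pull_coef_field G Y e a X p : local_data G Y e a -> G (i p) ->
  smooth_vfield_on [set: F] X ->
  exists (c : 'I_k -> F -> R) (V : set F),
  [/\ forall j, smooth (c j), open V, V p, V `<=` i @^-1` G
    & forall q, V q -> pushforward i (X q) = lincomb (Y^~ (i q)) (c^~ q)].
Proof.
move=> [oG fY _ _ _] Gp sX; apply: (frame_coef oG fY si Gp sX) => q.
by apply: iD; exact: sX.1.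
Qed.

Lemma pull_nabla_smooth X s : smooth_vfield_on [set: F] X -> smooth_csection s ->
  smooth_csection (pull_nabla X s).
Proof.
move=> sX ss; apply: smooth_csection_local => p.
have [G [Y [e [a [Gp ld]]]]] := exists_local_data (i p).
have [oG fY se sa aE] := ld.
have [h [V [sh oV Vp E]]] := pull_coef ss se (aE _ Gp).1.
have [c [V' [sc oV' Vp' VG cE]]] := pull_coef_field ld Gp sX.
exists (V `&` V'), (fun q => (cderiv (X q) h + h q * conn_form a c q) *: e (i q)).
split => //; first exact: openI.
  apply: (smooth_csectionZ (C := PB) _ (smooth_pullback_section (si := si) se)).
  exact: (csmooth_onD oF (csmooth_cderiv sX sh) (csmooth_onM oF sh (csmooth_conn_form sa sc))).
move=> q [Vq Vq'].
by apply: (pull_nabla_local ld _ sh oV Vq (VG _ Vq') E (cE _ Vq')); exact: sX.1.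
Qed.

Lemma section_tangentE (X : vfield F) : section_of (@tangent _ _ F) X ->
  smooth_vfield_on [set: F] X.
Proof. by case. Qed.

Lemma pull_connection : leafwise_connection (@tangent _ _ F) pull_nabla.
Proof.
split.
- by move=> X s /section_tangentE; exact: pull_nabla_smooth.
- move=> f X Y s sf /section_tangentE sX /section_tangentE sY ss p.
  have [e [se ep]] := nonvanishing_section C (i p).
  have [h [V [sh oV Vp E]]] := pull_coef ss se ep.
  have tX : tangent p (X p) by exact: sX.1.
  have tY : tangent p (Y p) by exact: sY.1.
  have [W [sW WX]] := section_through (iD tX).
  have [W' [sW' WY]] := section_through (iD tY).
  (* As [f] lives on [F], it enters on [Z] through the constant [f p], which gives the right vector
     at [i p]. *)
  have sWW := section_lin sD (@smooth_cst _ _ Z (f p)) sW sW'.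
  rewrite (pull_nablaE tX se sh sW WX oV Vp E).
  rewrite (pull_nablaE tY se sh sW' WY oV Vp E).
  rewrite (pull_nablaE (tangent_lin (f p) tX tY) se sh sWW _ oV Vp E); last first.
    rewrite WX WY; apply/funext => g; rewrite /Defs.pushforward.
    by case: asboolP; rewrite ?mulr0 ?addr0.
  rewrite /pull_value (nabla_field_lin hN _ (@smooth_cst _ _ Z (f p)) sW sW' se).
  rewrite (_ : cderiv _ h = Complex (f p) 0 * cderiv (X p) h + cderiv (Y p) h); last first.
    by apply: complex_eq; rewrite ?ReImE /= mul0r ?subr0 ?addr0.
  by rewrite scalerDl !scalerDr !scalerA [h p * _]mulrC addrACA.
- move=> X s s' /section_tangentE sX ss ss' p.
  have [e [se ep]] := nonvanishing_section C (i p).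
  have [h [V [sh oV Vp E]]] := pull_coef ss se ep.
  have [h' [V' [sh' oV' Vp' E']]] := pull_coef ss' se ep.
  have tX : tangent p (X p) by exact: sX.1.
  have [W [sW WX]] := section_through (iD tX).
  rewrite (pull_nablaE tX se sh sW WX oV Vp E).
  rewrite (pull_nablaE tX se sh' sW WX oV' Vp' E').
  have sS := csmooth_onD oF sh sh'.
  rewrite (pull_nablaE tX se sS sW WX (openI oV oV') (conj Vp Vp')); last first.
    by move=> q [Vq Vq']; rewrite E// E'// scalerDl.
  by rewrite /pull_value (cderivD tX sh sh') !scalerDl addrACA.
- move=> g X s sg /section_tangentE sX ss p.
  have [e [se ep]] := nonvanishing_section C (i p).
  have [h [V [sh oV Vp E]]] := pull_coef ss se ep.
  have tX : tangent p (X p) by exact: sX.1.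
  have [W [sW WX]] := section_through (iD tX).
  rewrite (pull_nablaE tX se sh sW WX oV Vp E).
  rewrite (pull_nablaE tX se (csmooth_onM oF sg sh) sW WX oV Vp); last first.
    by move=> q Vq; rewrite E// scalerA.
  rewrite /pull_value (cderivM tX sg sh) (E _ Vp).
  by rewrite scalerDl scalerDr !scalerA addrA.
Qed.

End PullConnection.

(** * Brackets, and leafwise two-forms on linear combinations *)

Lemma bracket_tangent (R : realType) (n : nat) (M : manifold R n)
    (X Y : vfield M) p :
  smooth_vfield_on [set: M] X -> smooth_vfield_on [set: M] Y ->
  tangent p (bracket X Y p).
Proof.
move=> [tX sX] [tY sY].
have oT : open [set: M] := openT.
have tXq q := tX q I; have tYq q := tY q I.
split.
- move=> c f g sf sg; rewrite /bracket.
  have lin (W : vfield M) : (forall q, tangent q (W q)) ->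
      (fun q => W q (fun q' => c * f q' + g q')) = (fun q => c * W q f + W q g).
    by move=> tW; apply/funext => q; have [l _ _] := tW q; exact: l.
  rewrite !lin//.
  have [lx _ _] := tXq p; have [ly _ _] := tYq p.
  by rewrite (lx _ _ _ (sY f sf) (sY g sg)) (ly _ _ _ (sX f sf) (sX g sg)); ring.
- move=> f g sf sg; rewrite /bracket.
  have lei (W : vfield M) : (forall q, tangent q (W q)) ->
      (fun q => W q (fun q' => f q' * g q')) = (fun q => W q f * g q + f q * W q g).
    by move=> tW; apply/funext => q; exact: (tangentM (tW q)).
  rewrite !lei//.
  rewrite (tangentD (tXq p) (smooth_onM oT (sY f sf) sg) (smooth_onM oT sf (sY g sg))).
  rewrite (tangentD (tYq p) (smooth_onM oT (sX f sf) sg) (smooth_onM oT sf (sX g sg))).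
  rewrite !(tangentM (tXq p))//; [|exact: sY|exact: sY].
  rewrite !(tangentM (tYq p))//; [|exact: sX|exact: sX].
  ring.
- move=> f nf; rewrite /bracket.
  have z (W : vfield M) : (forall q, tangent q (W q)) -> (fun q => W q f) = fun=> 0.
    by move=> tW; apply/funext => q; have [_ _ ->] := tW q.
  by rewrite !z// (tangent_cst (tXq p)) (tangent_cst (tYq p)) subr0.
Qed.

Lemma cderiv_bracket (R : realType) (n : nat) (M : manifold R n)
    (X Y : vfield M) p (h : M -> R[i]) :
  cderiv (bracket X Y p) h = cderiv (X p) (fun q => cderiv (Y q) h)
    - cderiv (Y p) (fun q => cderiv (X q) h).
Proof. by apply: complex_eq; rewrite ?ReImE. Qed.

(** Bilinearity of [W p] is available on [D p] only, so each partial sum has to be kept inside [D p]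
    along the induction. *)
Lemma leafwise2_lincomb (R : realType) (n k : nat) (M : manifold R n)
    (D : tangent_distribution M) (W : leafwise2 M) p
    (I J : Type) (r : seq I) (t : seq J) (b : I -> R) (c : J -> R)
    (X : I -> tvec M) (Y : J -> tvec M) :
  smooth_distribution k D -> leafwise_two_form D W ->
  (forall j, D p (X j)) -> (forall j, D p (Y j)) ->
  W p (fun f => \sum_(j <- r) b j * X j f) (fun f => \sum_(l <- t) c l * Y l f)
  = \sum_(j <- r) \sum_(l <- t) b j * c l * W p (X j) (Y l).
Proof.
move=> sD [linl linr _ _] DX DY.
have D0 : D p (fun=> 0) := distribution_zero sD p.
have Wl w : D p w -> W p (fun=> 0) w = 0.
  move=> Dw; have := linl p 1 _ _ _ D0 D0 Dw.
  under [X in W p X w]eq_fun do rewrite mulr0 addr0.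
  by rewrite mul1r => /eqP; rewrite -{1}[W _ _ _]addr0 (inj_eq (addrI _)) => /eqP <-.
have Wr w : D p w -> W p w (fun=> 0) = 0.
  move=> Dw; have := linr p 1 _ _ _ D0 D0 Dw.
  under [X in W p w X]eq_fun do rewrite mulr0 addr0.
  by rewrite mul1r => /eqP; rewrite -{1}[W _ _ _]addr0 (inj_eq (addrI _)) => /eqP <-.
have DS (K : Type) (s : seq K) (d : K -> R) (T : K -> tvec M) :
    (forall j, D p (T j)) -> D p (fun f => \sum_(j <- s) d j * T j f).
  move=> DT; elim: s => [|j s IH]; first by under eq_fun do rewrite big_nil.
  under eq_fun do rewrite big_cons; exact: (distribution_lin sD _ (DT j) IH).
elim: r => [|j r IH].
  by rewrite big_nil; under [X in W p X _]eq_fun do rewrite big_nil; rewrite Wl//; exact: DS.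
rewrite big_cons -IH; under [X in W p X _]eq_fun do rewrite big_cons.
rewrite (linl p (b j) _ _ _ (DX j) (DS _ r b X DX) (DS _ t c Y DY)); congr (_ + _).
elim: t {IH} => [|l t IHt].
  by rewrite big_nil; under [X in W p _ X]eq_fun do rewrite big_nil; rewrite Wr// mulr0.
rewrite big_cons -IHt; under [X in W p _ X]eq_fun do rewrite big_cons.
by rewrite (linr p (c l) _ _ _ (DY l) (DS _ t c Y DY) (DX j)) mulrDr mulrA.
Qed.

(** * Curvature of the pulled back connection *)

Section PullCurvature.
Variables (R : realType) (m n k : nat) (F : manifold R m) (Z : manifold R n).
Variables (D : tangent_distribution Z) (sD : smooth_distribution k D).
Variables (C : line_bundle Z) (nabla : vfield Z -> csection C -> csection C).
Hypothesis hN : leafwise_connection D nabla.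
Variables (i : F -> Z) (si : smooth_map i).
Hypothesis iD : forall p v, tangent p v -> D (i p) (pushforward i v).
Hypothesis invD : Defs.involutive D.
Variables (eps : R) (Om : leafwise2 Z).
Hypothesis hOm : leafwise_two_form D Om.
Hypothesis hcurv : forall X Y s, section_of D X -> section_of D Y ->
  smooth_csection s -> forall p, curvature nabla X Y s p
    = Complex 0 (eps * Om p (X p) (Y p)) *: s p.

Local Notation PB := (pullback_bundle si C).
Implicit Types (s : csection PB) (h : F -> R[i]).

Let oF : open [set: F] := openT.

(** Leibniz rule, with [v (u_l \o i) = (i_* v) u_l] expanded in the frame. It is applied to
    [u_l = Y_l f], to differentiate [X (f \o i)] once more. *)
Lemma tangent_pull_comb p (v : tvec F) (Y : 'I_k -> tvec Z) (b : 'I_k -> R)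
    (c : 'I_k -> F -> R) (u : 'I_k -> Z -> R) :
  tangent p v -> pushforward i v = lincomb Y b ->
  (forall l, smooth (c l)) -> (forall l, smooth (u l)) ->
  v (fun q => \sum_l c l q * u l (i q))
  = \sum_l (v (c l) * u l (i p) + c l p * \sum_j b j * Y j (u l)).
Proof.
move=> tv vE sc su.
have sui l : smooth (fun q => u l (i q)) := smooth_on_comp si openT (su l).
rewrite (tangent_sum tv); last by move=> l; exact: (smooth_onM oF (sc l) (sui l)).
apply: eq_bigr => l _; rewrite (tangentM tv (sc l) (sui l)); congr (_ + _ * _).
have := congr1 (fun w => w (u l)) vE; rewrite /lincomb => <-.
by rewrite /Defs.pushforward; case: asboolP => //; have := su l.
Qed.

Lemma cderiv_conn_form p (v : tvec F) (Y : 'I_k -> tvec Z) (b : 'I_k -> R)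
    (c : 'I_k -> F -> R) (a : 'I_k -> Z -> R[i]) :
  tangent p v -> pushforward i v = lincomb Y b ->
  (forall l, smooth (c l)) -> (forall l, csmooth (a l)) ->
  cderiv v (conn_form i a c)
  = \sum_l Complex (v (c l)) 0 * a l (i p)
    + \sum_j \sum_l Complex (b j * c l p) 0 * cderiv (Y j) (a l).
Proof.
move=> tv vE sc sa; rewrite /conn_form.
rewrite (cderiv_sum tv); last first.
  by move=> l; exact: (csmooth_onM oF (csmooth_on_real (sc l)) (csmooth_pull si (sa l))).
rewrite exchange_big -big_split /=; apply: eq_bigr => l _.
rewrite (cderivM tv (csmooth_on_real (sc l)) (csmooth_pull si (sa l))).
rewrite (cderiv_real tv); congr (_ + _).
rewrite -(cderiv_pushforward _ _ (sa l)) vE /lincomb cderiv_lincomb mulr_sumr.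
apply: eq_bigr => j _; rewrite mulrA; congr (_ * _).
by apply: complex_eq; rewrite ?ReImE /=; ring.
Qed.

Section AtPoint.
Variables (G : set Z) (Y : 'I_k -> vfield Z) (e : csection C) (a : 'I_k -> Z -> R[i]).
Hypothesis ld : local_data D nabla G Y e a.
Variables (X1 X2 : vfield F) (c1 c2 : 'I_k -> F -> R) (V : set F) (p : F).
Hypotheses (sX1 : smooth_vfield_on [set: F] X1) (sX2 : smooth_vfield_on [set: F] X2).
Hypotheses (sc1 : forall j, smooth (c1 j)) (sc2 : forall j, smooth (c2 j)).
Hypotheses (oV : open V) (Vp : V p) (VG : V `<=` i @^-1` G).
Hypothesis c1E : forall q, V q -> pushforward i (X1 q) = lincomb (Y^~ (i q)) (c1^~ q).
Hypothesis c2E : forall q, V q -> pushforward i (X2 q) = lincomb (Y^~ (i q)) (c2^~ q).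

Let d j := X1 p (c2 j) - X2 p (c1 j).
Let b (x : 'I_k * 'I_k) := c1 x.1 p * c2 x.2 p.

Let sY j : section_of D (Y j).
Proof. by case: ld => _ [+ _] _ _ _; exact. Qed.

(** A section of [D] extending the push-forward of the bracket at [i p], all coefficients being
    frozen at [p]. The factor [1] gives it the shape of the linearity axiom. *)
Let bracket_field : vfield Z := fun z f =>
  1 * (\sum_j d j * Y j z f) + \sum_x b x * bracket (Y x.1) (Y x.2) z f.

Lemma section_bracket_field : section_of D bracket_field.
Proof.
apply: (section_lin sD (@smooth_cst _ _ Z 1)).
  exact: (section_sum sD _ (fun j => @smooth_cst _ _ Z (d j)) sY).
apply: (section_sum sD _ (fun x => @smooth_cst _ _ Z (b x))) => x.
exact: (invD (sY x.1) (sY x.2)).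
Qed.

Lemma pushforward_bracket : bracket_field (i p) = pushforward i (bracket X1 X2 p).
Proof.
apply/funext => f; rewrite /Defs.pushforward; case: asboolP => sf; last first.
  by have [_ _ ->] := section_tangent (i p) section_bracket_field.
have sYf j : smooth (fun z => Y j z f) := section_smooth (sY j) sf.
have sfi : smooth (fun q => f (i q)) := smooth_on_comp si openT sf.
have comb (X : vfield F) (c : 'I_k -> F -> R) q :
    pushforward i (X q) = lincomb (Y^~ (i q)) (c^~ q) ->
    X q (fun r => f (i r)) = \sum_l c l q * Y l (i q) f.
  by move/(congr1 (fun w => w f)); rewrite /Defs.pushforward; case: asboolP.
have sS (c : 'I_k -> F -> R) : (forall j, smooth (c j)) ->
    smooth (fun q => \sum_l c l q * Y l (i q) f).
  move=> sc; apply: (smooth_on_sum _ oF) => l.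
  exact: (smooth_onM oF (sc l) (smooth_on_comp si openT (sYf l))).
rewrite [in RHS]/bracket.
rewrite (tangent_local (sX1.1 p I) oV Vp (sX2.2 _ sfi) (sS _ sc2)); last first.
  by move=> q Vq; apply: comb; exact: c2E.
rewrite (tangent_local (sX2.1 p I) oV Vp (sX1.2 _ sfi) (sS _ sc1)); last first.
  by move=> q Vq; apply: comb; exact: c1E.
rewrite (tangent_pull_comb (sX1.1 p I) (c1E Vp) sc2 sYf).
rewrite (tangent_pull_comb (sX2.1 p I) (c2E Vp) sc1 sYf).
rewrite /bracket_field mul1r !big_split /= opprD addrACA -sumrB; congr (_ + _).
  by apply: eq_bigr => j _; rewrite mulrBl.
rewrite -(pair_bigA _ (fun j l => b (j, l) * bracket (Y j) (Y l) (i p) f)) /=.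
rewrite [X in X - _](eq_bigr (fun l => \sum_j c1 j p * c2 l p * Y j (i p) (fun z => Y l z f))); last first.
  by move=> l _; rewrite mulr_sumr; apply: eq_bigr => j _; ring.
(* Once both double sums are indexed alike, the second derivatives of [f] combine into the brackets
   [[Y_j, Y_l]] with coefficients [c1_j c2_l]. *)
rewrite [X in _ = X - _]exchange_big -sumrB; apply: eq_bigr => j _.
rewrite mulr_sumr -sumrB; apply: eq_bigr => l _.
by rewrite /b /bracket /=; ring.
Qed.

(** The curvature hypothesis is solved for the bracket term. Each second derivative of [e]
    contributes the product of [a j] and [a l], which cancels in the commutator. *)
Lemma nabla_bracket_frame j l z : G z ->
  nabla (bracket (Y j) (Y l)) e z =
  (cderiv (Y j z) (a l) - cderiv (Y l z) (a j)
   + Complex 0 (eps * Om z (Y j z) (Y l z))) *: e z.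
Proof.
move=> Gz; have [oG _ se sa aE] := ld.
have H j' l' : nabla (Y j') (nabla (Y l') e) z
    = (cderiv (Y j' z) (a l') + a l' z * a j' z) *: e z.
  rewrite (nabla_local hN oG Gz (sY j') (nabla_smooth hN (sY l') se)
    (smooth_csectionZ (sa l') se) (fun z Gz => (aE z Gz).2 l')).
  by rewrite (nablaZ hN z (sa l') (sY j') se) ((aE z Gz).2 j') scalerA -scalerDl.
have := hcurv (sY j) (sY l) se z; rewrite /curvature !H => /eqP.
rewrite subr_eq => /eqP ->; rewrite -scalerBl -scalerDl; congr (_ *: _); ring.
Qed.

(** This is the structure equation for the pulled back connection form [A]: [A [X1, X2] = X1 (A X2)
    - X2 (A X1) + i eps Omega]. The part of the field with coefficients [d] accounts for the
    derivatives of [c1] and [c2], the part with coefficients [b] for those of [a] and for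
    [Omega]. *)
Lemma nabla_bracket_field : nabla bracket_field e (i p) =
  (cderiv (X1 p) (conn_form i a c2) - cderiv (X2 p) (conn_form i a c1)
   + Complex 0 (eps * Om (i p) (pushforward i (X1 p)) (pushforward i (X2 p))))
  *: e (i p).
Proof.
have [oG _ se sa aE] := ld; have Gp : G (i p) := VG Vp.
have sS1 := section_sum sD (index_enum 'I_k) (fun j => @smooth_cst _ _ Z (d j)) sY.
have sBr (x : 'I_k * 'I_k) := invD (sY x.1) (sY x.2).
have sS2 := section_sum sD (index_enum ('I_k * 'I_k)%type)
  (fun x => @smooth_cst _ _ Z (b x)) sBr.
rewrite (nabla_field_lin hN (i p) (@smooth_cst _ _ Z 1) sS1 sS2 se).
rewrite (nabla_field_sum sD hN _ _ (fun j => @smooth_cst _ _ Z (d j)) sY se).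
rewrite (nabla_field_sum sD hN _ _ (fun x => @smooth_cst _ _ Z (b x)) sBr se).
rewrite (_ : Complex 1 0 = 1) ?scale1r; last by [].
under eq_bigr do rewrite ((aE _ Gp).2) scalerA.
under [X in _ + X]eq_bigr do rewrite nabla_bracket_frame// scalerA.
rewrite -!scaler_suml -scalerDl; congr (_ *: _).
rewrite (cderiv_conn_form (sX1.1 p I) (c1E Vp) sc2 sa).
rewrite (cderiv_conn_form (sX2.1 p I) (c2E Vp) sc1 sa).
rewrite (c1E Vp) (c2E Vp).
have DY j : D (i p) (Y j (i p)) := (sY j).2 (i p).
rewrite /lincomb (leafwise2_lincomb _ _ _ _ sD hOm DY DY).
(* Additivity of multiplication by [i eps] distributes it over the double sum for [Omega]. *)
have add : {morph (fun x : R => Complex 0 (eps * x)) : x y / x + y}.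
  by move=> x y; apply: complex_eq; rewrite ?ReImE /= ?addr0// mulrDr.
have zero : Complex 0 (eps * 0) = 0 :> R[i] by rewrite mulr0.
rewrite (big_morph _ add zero).
under [X in _ = _ + X]eq_bigr do rewrite (big_morph _ add zero).
rewrite [X in _ - (_ + X)]exchange_big /=.
have rearrange (x y z t o : R[i]) : (x + y) - (z + t) + o = (x - z) + (y - t + o).
  by ring.
rewrite rearrange; congr (_ + _).
  rewrite -sumrB; apply: eq_bigr => j _; rewrite -mulrBl; congr (_ * _).
  by apply: complex_eq; rewrite ?ReImE /= ?oppr0 ?addr0.
rewrite -(pair_bigA _ (fun j l => Complex (b (j, l)) 0 *
  (cderiv (Y j (i p)) (a l) - cderiv (Y l (i p)) (a j)
   + Complex 0 (eps * Om (i p) (Y j (i p)) (Y l (i p)))))) /=.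
rewrite -sumrB -big_split; apply: eq_bigr => j _ /=.
rewrite -sumrB -big_split; apply: eq_bigr => l _ /=.
rewrite mulrDr mulrBr /b /=; congr (_ - _ * _ + _).
  by rewrite [c1 _ _ * _]mulrC.
by apply: complex_eq; rewrite ?ReImE /=; ring.
Qed.

End AtPoint.

(** For [s = h *: (e \o i)], the connection along [X] replaces [h] by [X h + h A(X)]. In the
    curvature the second derivatives of [h] cancel against the bracket, as do the mixed terms and
    the product [A(X1) A(X2)]. There remains [h] times [A [X1, X2] - X1 (A X2) + X2 (A X1)], given
    by the structure equation. *)
Lemma pull_curvature X1 X2 s p : section_of (@tangent _ _ F) X1 ->
  section_of (@tangent _ _ F) X2 -> smooth_csection s ->
  curvature (pull_nabla D nabla (si := si)) X1 X2 s p
  = Complex 0 (eps * pullback2 i Om p (X1 p) (X2 p)) *: s p.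
Proof.
move=> [sX1 _] [sX2 _] ss.
have [G [Y [e [a [Gp ld]]]]] := exists_local_data sD hN (i p).
have [oG fY se sa aE] := ld.
have [h [V0 [sh oV0 V0p E]]] := pull_coef ss se (aE _ Gp).1.
have [c1 [V1 [sc1 oV1 V1p V1G c1E]]] := pull_coef_field si iD ld Gp sX1.
have [c2 [V2 [sc2 oV2 V2p V2G c2E]]] := pull_coef_field si iD ld Gp sX2.
have oV12 : open (V1 `&` V2) := openI oV1 oV2.
pose h1 q := cderiv (X1 q) h + h q * conn_form i a c1 q.
pose h2 q := cderiv (X2 q) h + h q * conn_form i a c2 q.
have sf1 := csmooth_conn_form si sa sc1.
have sf2 := csmooth_conn_form si sa sc2.
have sd1 := csmooth_cderiv sX1 sh.
have sd2 := csmooth_cderiv sX2 sh.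
have sp1 := csmooth_onM oF sh sf1.
have sp2 := csmooth_onM oF sh sf2.
have sh1 : csmooth h1 := csmooth_onD oF sd1 sp1.
have sh2 : csmooth h2 := csmooth_onD oF sd2 sp2.
(* The derivative is again a function times [e \o i] on a neighbourhood, not only at [p], so the
   local formula can be applied a second time. *)
have E1 q : (V0 `&` V1) q -> pull_nabla D nabla (si := si) X1 s q = h1 q *: e (i q).
  move=> [V0q V1q].
  exact: (pull_nabla_local sD hN ld (sX1.1 q I) sh oV0 V0q (V1G _ V1q) E (c1E _ V1q)).
have E2 q : (V0 `&` V2) q -> pull_nabla D nabla (si := si) X2 s q = h2 q *: e (i q).
  move=> [V0q V2q].
  exact: (pull_nabla_local sD hN ld (sX2.1 q I) sh oV0 V0q (V2G _ V2q) E (c2E _ V2q)).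
rewrite /curvature.
rewrite (pull_nabla_local sD hN ld (sX1.1 p I) sh2 (openI oV0 oV2) (conj V0p V2p) Gp E2 (c1E _ V1p)).
rewrite (pull_nabla_local sD hN ld (sX2.1 p I) sh1 (openI oV0 oV1) (conj V0p V1p) Gp E1 (c2E _ V2p)).
have c1E' q : (V1 `&` V2) q -> pushforward i (X1 q) = lincomb (Y^~ (i q)) (c1^~ q).
  by case=> /c1E.
have c2E' q : (V1 `&` V2) q -> pushforward i (X2 q) = lincomb (Y^~ (i q)) (c2^~ q).
  by case=> _ /c2E.
have V12p : (V1 `&` V2) p by [].
have V12G : V1 `&` V2 `<=` i @^-1` G by move=> q [/V1G].
have tB := bracket_tangent p sX1 sX2.
rewrite (pull_nablaE sD hN tB se sh (section_bracket_field ld X1 X2 c1 c2 p)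
  (pushforward_bracket ld sX1 sX2 sc1 sc2 oV12 V12p c1E' c2E') oV0 V0p E).
rewrite /pull_value (nabla_bracket_field ld sX1 sX2 sc1 sc2 V12p V12G c1E' c2E').
rewrite (E _ V0p) /pullback2 !scalerA -!scalerBl -scalerDl -scalerBl; congr (_ *: _).
rewrite cderiv_bracket.
rewrite (cderivD (sX1.1 p I) sd2 sp2) (cderivD (sX2.1 p I) sd1 sp1).
rewrite (cderivM (sX1.1 p I) sh sf2) (cderivM (sX2.1 p I) sh sf1) /h1 /h2.
ring.
Qed.

End PullCurvature.

Theorem proposition8 (R : realType) (eps : R) (heps : 0 < eps)
  (n k : nat) (Z : manifold R n) (D : tangent_distribution Z) (Omega : leafwise2 Z)
  (hsymp : symplectic_foliation k D Omega)
  (hpreq : admits_prequantization eps D Omega)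
  (F : manifold R k) (i : F -> Z) (hleaf : leaf D i) :
  symplectic_manifold_admits_prequantization eps (pullback2 i Omega).
Proof.
have [[sD invD] _ hOm _ _] := hsymp.
have [C [nabla [hN hcurv]]] := hpreq.
have [[_ [si _] iD] _] := hleaf.
have iD' p v : tangent p v -> D (i p) (pushforward i v).
  by move=> tv; rewrite -iD; exists v.
exists (pullback_bundle si C), (pull_nabla D nabla (si := si)); split.
  exact: (pull_connection sD hN si iD').
by move=> X Y s sX sY ss p; exact: (pull_curvature sD hN iD' invD hOm hcurv).
Qed.
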